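(* There exist absolute constants $C,c_1,c_2,a,b\in(0,\infty)$ with $a\le b$ such that the following holds. Let $1\le p\le\infty$, $m\in\mathbb{N}$, $1\le n<m$ an integer, and let $\sigma_1\ge\cdots\ge\sigma_m>0$ be real numbers. Let $p^*$ be the Hölder conjugate of $p$. Then there is a real number $k>0$, with $an\le k\le bn$ if $p=1$ and with $a\frac{n}{p^*}\le k\le b\frac{n}{p^*}$ if $p>1$, such that, with probability at least $1-c_1\exp(-c_2 n)$, $$ \mathrm{rad}(\mathcal{E}_{p,\sigma}^{m},G_{n,m})\le \begin{cases} C\, n^{-1/2}\sup\limits_{k\le j\le m}\sigma_{j}\sqrt{\log(j)+1} & \text{if } p=1,\\ C\,\sqrt{p^*}\,n^{-1/2}\Big(\sum\limits_{k\le j\le m}\sigma_{j}^{p^{*}}\Big)^{1/p^{*}} & \text{if } 1<p\le\infty, \end{cases} $$ where the supremum and the sum range over integers $j\ge 1$ with $k\le j\le m$.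
   Context: For $0<p\le\infty$, $\|\cdot\|_p$ denotes the $\ell_p$-(quasi-)norm on $\mathbb{R}^m$: $\|x\|_p=(|x_1|^p+\cdots+|x_m|^p)^{1/p}$ for $p<\infty$ and $\|x\|_\infty=\max_j|x_j|$. For semiaxes $\sigma_1\ge\cdots\ge\sigma_m>0$, the $\ell_p$-ellipsoid is $\mathcal{E}_{p,\sigma}^m=\{x\in\mathbb{R}^m:\|(x_j/\sigma_j)_{j=1}^m\|_p\le 1\}$. $G_{n,m}\in\mathbb{R}^{n\times m}$ is a random matrix with i.i.d. standard Gaussian entries, and $\mathrm{rad}(\mathcal{E}_{p,\sigma}^m,G_{n,m}):=\sup\{\|x\|_2: x\in\mathcal{E}_{p,\sigma}^m,\ G_{n,m}x=0\}$. The Hölder conjugate $p^*$ of $p\in[1,\infty]$ is given by $\frac1p+\frac1{p^*}=1$ (with $1/\infty=0$). *)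

(* Defs.v *)
From HB Require Import structures.
From mathcomp Require Export all_boot all_order all_algebra.
From mathcomp Require Export all_classical all_reals all_analysis.

Set Implicit Arguments.
Unset Strict Implicit.
Unset Printing Implicit Defensive.

Import Order.TTheory GRing.Theory Num.Theory.
Import numFieldNormedType.Exports.

Local Open Scope classical_set_scope.
Local Open Scope ring_scope.

(* Meaningful for 0 < p <= +oo only; the value at -oo is a dummy. *)
Definition lpnorm (R : realType) (m : nat) (p : \bar R) (x : 'cV[R]_m) : R :=
  match p with
  | r%:E => (\sum_(j < m) `|x j 0| `^ r) `^ r^-1
  | +oo%E => \big[Num.max/0]_(j < m) `|x j 0|
  | -oo%E => 0
  end.

Definition ellipsoid (R : realType) (m : nat) (p : \bar R) (sigma : 'I_m -> R)
    : set 'cV[R]_m :=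
  [set x | lpnorm p (\col_j (x j 0 / sigma j)) <= 1].

Definition rad (R : realType) (n m : nat) (K : set 'cV[R]_m)
    (A : 'M[R]_(n, m)) : \bar R :=
  ereal_sup [set (lpnorm 2%:E x)%:E | x in K `&` [set x | A *m x = 0]].

Definition mutually_independent d (T : measurableType d) (R : realType)
    (P : probability T R) (I : finType) (X : I -> {RV P >-> R}) : Prop :=
  forall (J : {set I}) (B : I -> set R),
    (forall i, i \in J -> measurable (B i)) ->
    P (\bigcap_(i in [set` J]) X i @^-1` B i)
      = (\prod_(i in J) P (X i @^-1` B i))%E.

Definition standard_gaussian d (T : measurableType d) (R : realType)
    (P : probability T R) (X : {RV P >-> R}) : Prop :=
  forall B : set R, measurable B -> distribution P X B = normal_prob 0 1 B.

Definition gaussian_matrix d (T : measurableType d) (R : realType)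
    (P : probability T R) (n m : nat) (G : 'I_n -> 'I_m -> {RV P >-> R})
    : Prop :=
  (forall i j, standard_gaussian (G i j)) /\
  mutually_independent (fun ij : 'I_n * 'I_m => G ij.1 ij.2).

Definition matrix_at d (T : measurableType d) (R : realType)
    (P : probability T R) (n m : nat) (G : 'I_n -> 'I_m -> {RV P >-> R})
    (w : T) : 'M[R]_(n, m) :=
  \matrix_(i, j) G i j w.

(* Used for p > 1 only, where the conjugate is finite. *)
Definition pconj (R : realType) (p : \bar R) : R := fine (hoelder_conjugate p).

(* Semiaxes are indexed from 0: sigma j is the (j + 1)-st one. Both ranges are
   empty, and the bound is 0, when k > m. *)
Definition rad_bound (R : realType) (C : R) (p : \bar R) (n m : nat)
    (sigma : 'I_m -> R) (k : R) : R :=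
  if p == 1%E then
    C * (Num.sqrt n%:R)^-1 *
      \big[Num.max/0]_(j < m | k <= j.+1%:R)
        (sigma j * Num.sqrt (ln j.+1%:R + 1))
  else
    C * Num.sqrt (pconj p) * (Num.sqrt n%:R)^-1 *
      (\sum_(j < m | k <= j.+1%:R) sigma j `^ pconj p) `^ (pconj p)^-1.

(* Main.v *)
From HB Require Import structures.
From mathcomp Require Import measurable_realfun.
From mathcomp Require Import ring lra.
Require Import Defs.

Set Implicit Arguments.
Unset Strict Implicit.
Unset Printing Implicit Defensive.

Import Order.TTheory GRing.Theory Num.Theory.
Import numFieldNormedType.Exports.

Local Open Scope classical_set_scope.
Local Open Scope ring_scope.

(** Why the theorem holds. Suppose that some [x] in the ellipsoid, longer than the
    claimed bound [B], is in the kernel of the Gaussian matrix. After rescaling,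
    there is [u] with [delta <= |u| <= 2 delta] and with norm at most
    [2 delta / B] in the norm of the ellipsoid, such that
    [sum_i |<g_i, u>| = 0] for the rows [g_i] of the matrix. Each [<g_i, u>] is
    Gaussian with standard deviation at least [delta], so that
    [E exp |<g_i, u>| >= exp (delta / 6)]; for a single [u] the event is
    therefore exponentially unlikely in [n]. What has to be controlled is the
    maximum over all [u], that is, the expectation of
    [max_u prod_i exp (delta / 6 - |<g_i, u>|)].

    This is done by symmetrization, one row at a time (row_symmetrization,
    rows_symmetrization): the expectation is at most that of
    [max_u exp (2 sqrt n <g, u>)] for a single Gaussian vector [g], by the
    arithmetic-geometric inequality, symmetry, and stability of the Gaussian
    law. Only finite families of [u] occur, so that the maximum is measurable.

    The linear form is then bounded coordinate by coordinate (escape_tail). A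
    coordinate before the index [k] costs [8 n u_j ^ 2 + g_j ^ 2 / 8]: the first
    terms add up to at most [32 n delta ^ 2], which is half of the gain
    [n delta / 6] when [delta = 1 / 384], and the second ones contribute a
    constant factor each, which is why [k] must be at most a small multiple of
    [n]. In the tail, the norm of the ellipsoid is used. For [p = 1] (escape_one) the
    coordinate is bounded by [|g_j| <= 4 sqrt (log j + 1)] except on an event
    whose contribution is summable in [j]. For [p > 1] (escape_gt1) Young's
    inequality separates [u_j] from [|g_j| ^ q], with [q] the conjugate exponent,
    and the factor [sqrt q] in [B] keeps [(|g_j| / (2 sqrt q)) ^ q] below
    [exp (g_j ^ 2 / 8)]. In both cases independence of the coordinates turns the
    sum into a product of one-dimensional Gaussian integrals. Markov's inequality
    concludes (escape_bound).

    The passage from finite families to the ellipsoid, and the measurability of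
    the event, go through rational vectors: near a kernel vector there is a
    rational vector that is almost annihilated (escapes_shell), and by
    compactness the existence of such vectors for all accuracies characterizes
    the event (escapesP). The hypotheses on the matrix enter only through the
    identification of its law with a power of the Gaussian law
    (gaussian_matrix_law). *)


(** * One-dimensional Gaussian integrals *)

Section GaussianLine.
Variable R : realType.
Local Notation mu := (@lebesgue_measure R).
Local Notation gamma := (@normal_prob R 0 1).
Implicit Types (f : R -> \bar R) (a b c m s : R).

(** The density is identified with the Radon-Nikodym derivative, for which the
    change of variables is available. *)
Lemma ge0_integral_normal_prob m s f :
  measurable_fun [set: R] f -> (forall x, (0 <= f x)%E) ->
  (\int[normal_prob m s]_x f x = \int[mu]_x (f x * (normal_pdf m s x)%:E))%E.
Proof.
move=> mf f0.
have dom : normal_prob m s `<< mu by exact: normal_prob_dominates.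
rewrite -(Radon_Nikodym_SigmaFinite.change_of_variables dom)//.
have gint := Radon_Nikodym_SigmaFinite.f_integrable dom.
have mpdf : measurable_fun [set: R] (fun x => (normal_pdf m s x)%:E).
  by apply/measurable_EFinP; exact: measurable_normal_pdf.
apply: ge0_ae_eq_integral => //.
- by apply: emeasurable_funM => //; exact: measurable_int gint.
- exact: emeasurable_funM.
- by move=> x _; rewrite mule_ge0// Radon_Nikodym_SigmaFinite.f_ge0.
- by move=> x _; rewrite mule_ge0// lee_fin normal_pdf_ge0.
apply: ae_eqe_mul2l; apply: integral_ae_eq => // E _ mE.
by rewrite -Radon_Nikodym_SigmaFinite.f_integral.
Qed.

Lemma lebesgue_measure_affine a b (A : set R) : 0 < b -> measurable A ->
  (mu A = b%:E * mu ((fun y => (a + b * y)%R) @^-1` A))%E.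
Proof.
move=> b0 mA.
have mphi : measurable_fun [set: R] (fun y => a + b * y).
  by apply: measurable_funD => //; exact: measurable_funM.
pose phi : measurableTypeR R -> measurableTypeR R := fun y => a + b * y.
pose nu := mscale (NngNum (ltW b0))
  (measure_function_pushforward__canonical__measure_function_Measure mu
     (mphi : measurable_fun setT phi)).
rewrite (_ : (_ * _)%E = nu A)//.
apply: lebesgue_measure_unique => //= _ [[c d]] _ <-.
rewrite /nu /mscale/= /pushforward.
rewrite (_ : _ @^-1` _ = `](c - a) / b, (d - a) / b]%classic); last first.
  apply/seteqP; split => x /=; rewrite !in_itv/= ltr_pdivrMr// ler_pdivlMr//.
    by rewrite ltrBlDl lerBrDl (mulrC x).
  by rewrite ltrBlDl lerBrDl (mulrC x).
rewrite !lebesgue_measure_itv/= !lte_fin ltr_pM2r ?invr_gt0// ltrD2r.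
case: ifP => _; last by rewrite mule0.
rewrite -!EFinB -EFinM; congr EFin; field; exact: lt0r_neq0.
Qed.

Lemma ge0_integral_affine a b f : 0 < b ->
  measurable_fun [set: R] f -> (forall x, (0 <= f x)%E) ->
  (\int[mu]_x f x = b%:E * \int[mu]_y f (a + b * y)%R)%E.
Proof.
move=> b0 mf f0.
have mphi : measurable_fun [set: R] (fun y => a + b * y).
  by apply: measurable_funD => //; exact: measurable_funM.
pose phi : measurableTypeR R -> measurableTypeR R := fun y => a + b * y.
pose nu := mscale (NngNum (ltW b0))
  (measure_function_pushforward__canonical__measure_function_Measure mu
     (mphi : measurable_fun setT phi)).
transitivity (\int[nu]_x f x)%E.
  by apply: eq_measure_integral => A mA _; exact: lebesgue_measure_affine.
rewrite ge0_integral_mscale//=; congr (_ * _)%E.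
by rewrite ge0_integral_pushforward//= ?preimage_setT.
Qed.

Lemma normal_pdfNx x : normal_pdf (0 : R) 1 (- x) = normal_pdf 0 1 x.
Proof.
by rewrite /normal_pdf oner_eq0 /normal_fun !subr0 sqrrN.
Qed.

Lemma ge0_integral_gaussN f :
  measurable_fun [set: R] f -> (forall x, (0 <= f x)%E) ->
  (\int[gamma]_x f (- x)%R = \int[gamma]_x f x)%E.
Proof.
move=> mf f0.
have mN : measurable_fun [set: R] (-%R : R -> R) by exact: measurable_funN.
have mpdf : measurable_fun [set: R] (fun x : R => (normal_pdf 0 1 x)%:E).
  by apply/measurable_EFinP; exact: measurable_normal_pdf.
have mg : measurable_fun [set: R] (fun x => f x * (normal_pdf 0 1 x)%:E)%E.
  exact: emeasurable_funM.
rewrite !ge0_integral_normal_prob//; last exact: measurableT_comp.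
pose phi : measurableTypeR R -> measurableTypeR R := -%R.
pose nu := measure_function_pushforward__canonical__measure_function_Measure mu
  (mN : measurable_fun setT phi).
transitivity (\int[nu]_x (f x * (normal_pdf 0 1 x)%:E))%E; last first.
  by apply: eq_measure_integral => A mA _; exact: lebesgue_measureN.
have g0 (x : R) : (0 <= f x * (normal_pdf 0 1 x)%:E)%E.
  by rewrite mule_ge0// lee_fin normal_pdf_ge0.
rewrite (@ge0_integral_pushforward _ _ _ _ R phi mN mu setT _ measurableT mg).
  rewrite preimage_setT; apply: eq_integral => x _ /=.
  by rewrite /phi normal_pdfNx.
by move=> x _; exact: g0.
Qed.

Lemma ge0_integral_gauss_affine a b f : b != 0 ->
  measurable_fun [set: R] f -> (forall x, (0 <= f x)%E) ->
  (\int[gamma]_y f (a + b * y)%R = \int[normal_prob a b]_z f z)%E.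
Proof.
have mphi c : measurable_fun [set: R] (fun y => a + c * y).
  by apply: measurable_funD => //; exact: measurable_funM.
have pos c : 0 < c -> measurable_fun [set: R] f -> (forall x, (0 <= f x)%E) ->
    (\int[gamma]_y f (a + c * y)%R = \int[normal_prob a c]_z f z)%E.
  move=> c0 mf f0.
  have mfa : measurable_fun [set: R] (fun y => f (a + c * y)).
    exact: (measurableT_comp mf (mphi c)).
  rewrite (ge0_integral_normal_prob 0 1 mfa (fun y => f0 _)).
  rewrite (ge0_integral_normal_prob a c mf f0).
  have mpdf : measurable_fun [set: R] (fun x : R => (normal_pdf a c x)%:E).
    by apply/measurable_EFinP; exact: measurable_normal_pdf.
  have fp0 x : (0 <= f x * (normal_pdf a c x)%:E)%E.
    by rewrite mule_ge0// lee_fin normal_pdf_ge0.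
  have mfp : measurable_fun [set: R] (fun x => f x * (normal_pdf a c x)%:E)%E.
    exact: emeasurable_funM.
  have mfpa : measurable_fun [set: R] (fun y =>
      f (a + c * y)%R * (normal_pdf a c (a + c * y)%R)%:E)%E.
    exact: (measurableT_comp mfp (mphi c)).
  rewrite (ge0_integral_affine a c0 mfp fp0).
  have c0' : (0 <= c%:E)%E by rewrite lee_fin ltW.
  transitivity (\int[mu]_y (c%:E *
      (f (a + c * y)%R * (normal_pdf a c (a + c * y)%R)%:E)))%E; last first.
    apply: ge0_integralZl; first exact: measurableT.
    - exact: mfpa.
    - by move=> y _; exact: fp0.
    - exact: c0'.
  apply: eq_integral => y _; rewrite muleCA -EFinM; congr (_ * _%:E)%E.
  rewrite /normal_pdf oner_eq0 gt_eqF// /normal_peak /normal_fun mulrA.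
  congr (_ * expR _); last first.
    by field; exact: lt0r_neq0.
  rewrite expr1n mul1r -[_ ^+ 2 * _ *+ 2]mulrnAr sqrtrM ?sqr_ge0//.
  by rewrite sqrtr_sqr gtr0_norm// invfM mulrA divff ?mul1r// gt_eqF.
move=> b0 mf f0; have [bp|bn|b00] := ltgtP 0 b; first exact: pos.
- have mfa : measurable_fun [set: R] (fun y => f (a + b * y)).
    exact: (measurableT_comp mf (mphi b)).
  transitivity (\int[gamma]_y f (a + (- b) * y)%R)%E.
    rewrite -(ge0_integral_gaussN mfa (fun y => f0 _)).
    by apply: eq_integral => y _; rewrite mulrN -mulNr.
  have bN : 0 < - b by rewrite oppr_gt0.
  rewrite (pos (- b) bN mf f0).
  by rewrite /normal_prob /normal_pdf oppr_eq0 /normal_peak /normal_fun sqrrN.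
- by case/negP: b0; rewrite -b00 eqxx.
Qed.

(** Completing the square: the joint density of [(a x + b y, x)] splits as the
    density of [a x + b y] times the conditional density of [x]. *)
Lemma normal_pdf_mul a b c x z : b != 0 -> 0 < c -> a ^+ 2 + b ^+ 2 = c ^+ 2 ->
  normal_pdf (a * x) b z * normal_pdf 0 1 x =
  normal_pdf 0 c z * normal_pdf (a * z / c ^+ 2) (b / c) x.
Proof.
move=> b0 c0 abc; have cN0 : c != 0 by rewrite gt_eqF.
rewrite /normal_pdf (negbTE b0) (negbTE cN0) oner_eq0.
have -> : (b / c == 0) = false.
  by apply/negbTE; rewrite mulf_neq0// invr_eq0.
rewrite mulrACA [RHS]mulrACA; congr (_ * _).
  rewrite /normal_peak -!invfM -!sqrtrM; first last.
  - by rewrite -mulrnAr mulr_ge0 ?sqr_ge0// mulrn_wge0// pi_ge0.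
  - by rewrite -mulrnAr mulr_ge0 ?sqr_ge0// mulrn_wge0// pi_ge0.
  congr ((Num.sqrt _)^-1); field; exact: cN0.
rewrite /normal_fun -!expRD; congr expR.
transitivity (- (z ^+ 2 - 2 * a * x * z + (a ^+ 2 + b ^+ 2) * x ^+ 2)
    / (b ^+ 2 * 2)); first by field.
transitivity (- ((a ^+ 2 + b ^+ 2) / c ^+ 2 * z ^+ 2 - 2 * a * x * z +
    c ^+ 2 * x ^+ 2) / (b ^+ 2 * 2)); last by field; rewrite cN0 b0.
by rewrite abc divff ?mul1r// sqrf_eq0.
Qed.

(** After the change of variable [z = a x + b y] in the inner integral, the
    splitting of the joint density leaves a total mass [1] in [x]. *)
Lemma ge0_integral_gauss2_pos a b c f : b != 0 -> 0 < c ->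
  a ^+ 2 + b ^+ 2 = c ^+ 2 ->
  measurable_fun [set: R] f -> (forall x, (0 <= f x)%E) ->
  (\int[gamma]_x \int[gamma]_y f (a * x + b * y)%R = \int[gamma]_x f (c * x)%R)%E.
Proof.
move=> b0 c0 abc mf f0.
have cN0 : c != 0 by rewrite gt_eqF.
transitivity (\int[normal_prob 0 c]_z f z)%E; last first.
  rewrite -(ge0_integral_gauss_affine 0 cN0 mf f0).
  by apply: eq_integral => x _; rewrite add0r.
have mpdf : measurable_fun [set: R] (fun x : R => (normal_pdf 0 1 x)%:E).
  by apply/measurable_EFinP; exact: measurable_normal_pdf.
pose j (u : R * R) := (f u.2 * (normal_pdf (a * u.1) b u.2)%:E)%E.
have j0 u : (0 <= j u)%E by rewrite mule_ge0// lee_fin normal_pdf_ge0.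
have mj : measurable_fun [set: R * R] j.
  apply: emeasurable_funM; first exact: (measurableT_comp mf).
  apply/measurable_EFinP; rewrite /normal_pdf (negbTE b0).
  apply: measurable_funM => //; rewrite /normal_fun.
  apply: measurableT_comp => //; apply: measurable_funM => //.
  apply: measurable_funN; apply: measurable_funX; apply: measurable_funB => //.
  exact: measurable_funM.
transitivity (\int[gamma]_x \int[mu]_z j (x, z))%E.
  apply: eq_integral => x _.
  rewrite (ge0_integral_gauss_affine (a * x) b0 mf f0).
  by rewrite (ge0_integral_normal_prob (a * x) b mf f0).
have mJ : measurable_fun [set: R] (fun x => \int[mu]_z j (x, z))%E.
  by apply: (measurable_fun_fubini_tonelli_F (m2 := mu) j); [exact: mj|exact: j0].
have J0 (x : R) : (0 <= \int[mu]_z j (x, z))%E by apply: integral_ge0.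
rewrite (ge0_integral_normal_prob 0 1 mJ J0).
pose k (u : R * R) := (j u * (normal_pdf 0 1 u.1)%:E)%E.
have k0 u : (0 <= k u)%E by rewrite mule_ge0// lee_fin normal_pdf_ge0.
have mk : measurable_fun [set: R * R] k.
  by apply: emeasurable_funM => //; exact: (measurableT_comp mpdf).
transitivity (\int[mu]_x \int[mu]_z k (x, z))%E.
  apply: eq_integral => x _; rewrite -ge0_integralZr//.
  - exact: (measurableT_comp mj).
  - by rewrite lee_fin normal_pdf_ge0.
transitivity (\int[mu]_z \int[mu]_x k (x, z))%E.
  by apply: (fubini_tonelli (m1 := mu) (m2 := mu) k); [exact: mk|exact: k0].
rewrite (ge0_integral_normal_prob 0 c mf f0); apply: eq_integral => z _.
transitivity (\int[mu]_x (f z * (normal_pdf 0 c z)%:E *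
    (normal_pdf (a * z / c ^+ 2) (b / c) x)%:E))%E.
  apply: eq_integral => x _.
  by rewrite /k /j/= -muleA -EFinM (normal_pdf_mul _ _ b0 c0 abc) EFinM muleA.
rewrite ge0_integralZl//.
- by rewrite integral_normal_pdf mule1.
- by apply/measurable_EFinP; exact: measurable_normal_pdf.
- by move=> x _; rewrite lee_fin normal_pdf_ge0.
- by rewrite mule_ge0// lee_fin normal_pdf_ge0.
Qed.

Lemma ge0_integral_gauss2 a b c f : 0 <= c -> a ^+ 2 + b ^+ 2 = c ^+ 2 ->
  measurable_fun [set: R] f -> (forall x, (0 <= f x)%E) ->
  (\int[gamma]_x \int[gamma]_y f (a * x + b * y)%R = \int[gamma]_x f (c * x)%R)%E.
Proof.
move=> c0 abc mf f0; have [b0|bN0] := eqVneq b 0; last first.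
  apply: ge0_integral_gauss2_pos => //; rewrite lt_neqAle c0 andbT eq_sym.
  apply: contra bN0 => /eqP c00; move: abc; rewrite c00 expr0n/= => /eqP.
  by rewrite paddr_eq0 ?sqr_ge0// => /andP[_]; rewrite sqrf_eq0.
have m d : measurable_fun [set: R] (fun x => f (d * x)).
  by apply: (measurableT_comp mf); exact: measurable_funM.
transitivity (\int[gamma]_x f (a * x)%R)%E.
  apply: eq_integral => x _.
  transitivity (\int[gamma]_y (cst (f (a * x)%R) y))%E.
    by apply: eq_integral => y _; rewrite b0 mul0r addr0.
  by rewrite integral_cst//= probability_setT mule1.
have {abc} : (a == c) || (a == - c).
  by rewrite -eqf_sqr -abc b0 expr0n addr0.
case/orP => /eqP ->; first by [].
rewrite -(ge0_integral_gaussN (m c) (fun y => f0 _)).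
by apply: eq_integral => x _; rewrite mulNr -mulrN.
Qed.

(** The exponential factor turns the standard density into [s] times the density
    of variance [s ^ 2]. *)
Lemma integral_gauss_expR_sqr s : 0 < s ->
  (\int[gamma]_x (expR ((1 - s ^- 2) / 2 * x ^+ 2))%:E = s%:E)%E.
Proof.
move=> s0; have sN0 : s != 0 by rewrite gt_eqF.
have me : measurable_fun [set: R]
    (fun x : R => (expR ((1 - s ^- 2) / 2 * x ^+ 2))%:E).
  apply/measurable_EFinP; apply: measurableT_comp => //.
  by apply: measurable_funM => //; exact: measurable_funX.
have e0 (x : R) : (0 <= (expR ((1 - s ^- 2) / 2 * x ^+ 2))%:E)%E.
  by rewrite lee_fin expR_ge0.
rewrite (ge0_integral_normal_prob 0 1 me e0).
transitivity (\int[mu]_x (s%:E * (normal_pdf 0 s x)%:E))%E; last first.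
  rewrite ge0_integralZl ?lee_fin ?ltW//.
  + by rewrite integral_normal_pdf mule1.
  + by apply/measurable_EFinP; exact: measurable_normal_pdf.
  + by move=> x _; rewrite lee_fin normal_pdf_ge0.
apply: eq_integral => x _; rewrite -!EFinM; congr EFin.
rewrite /normal_pdf oner_eq0 (negbTE sN0) /normal_peak /normal_fun mulrCA.
rewrite -expRD [RHS]mulrA; congr (_ * expR _); last by field.
rewrite expr1n mul1r -[_ ^+ 2 * _ *+ 2]mulrnAr sqrtrM ?sqr_ge0//.
by rewrite sqrtr_sqr gtr0_norm// invfM mulrA divff ?mul1r.
Qed.

End GaussianLine.

Lemma ge0_le_integralT d (T : measurableType d) (R : realType)
    (mu : {measure set T -> \bar R}) (f1 f2 : T -> \bar R) :
  (forall x, (0 <= f1 x)%E) ->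
  measurable_fun setT f1 -> measurable_fun setT f2 ->
  (forall x, (f1 x <= f2 x)%E) ->
  (\int[mu]_x f1 x <= \int[mu]_x f2 x)%E.
Proof.
move=> f0 m1 m2 le12; apply: (ge0_le_integral _ measurableT _ m1 m2).
- by move=> x _; exact: f0.
- by move=> x _; exact: le12.
Qed.

Lemma integral_cstT d (T : measurableType d) (R : realType)
    (P : probability T R) (c : \bar R) : (\int[P]_x c = c)%E.
Proof. by rewrite integral_cst//= probability_setT mule1. Qed.

(** The standard Gaussian law, as a probability on the line with its Borel
    sigma-algebra under the default display, so that it can be tensorized with
    other measurable types. *)
Definition gauss (R : realType) : set R -> \bar R := normal_prob 0 1.

Section Gauss.
Variable R : realType.
Local Notation gauss := (@gauss R).
Implicit Types (f : R -> \bar R) (a b c s x : R).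

Let gauss0 : gauss set0 = 0%E. Proof. exact: measure0. Qed.
Let gauss_ge0 A : (0 <= gauss A)%E. Proof. exact: measure_ge0. Qed.
Let gauss_sigma_additive : semi_sigma_additive gauss.
Proof.
move=> F mF tF mU; exact: (@measure_semi_sigma_additive _ _ _ (@normal_prob R 0 1) F mF tF mU).
Qed.

HB.instance Definition _ := isMeasure.Build _ R R gauss
  gauss0 gauss_ge0 gauss_sigma_additive.

Let gauss_setT : gauss [set: R] = 1%E.
Proof. exact: (@probability_setT _ _ _ (@normal_prob R 0 1)). Qed.

HB.instance Definition _ := @Measure_isProbability.Build _ R R gauss gauss_setT.

(** The two measures differ only in the presentation of the Borel sigma-algebra;
    the identity map transports one to the other. *)
Lemma ge0_integral_gaussE f :
  measurable_fun [set: R] f -> (forall x, (0 <= f x)%E) ->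
  (\int[gauss]_x f x = \int[normal_prob 0 1]_x f x)%E.
Proof.
move=> mf f0; pose phi : measurableTypeR R -> R := id.
have mphi : measurable_fun [set: measurableTypeR R] phi.
  by move=> _ Y mY; rewrite setTI.
pose nu := measure_function_pushforward__canonical__measure_function_Measure
  (@normal_prob R 0 1) mphi.
transitivity (\int[nu]_x f x)%E.
  by apply: eq_measure_integral => A mA _.
rewrite (@ge0_integral_pushforward _ _ _ _ R phi mphi _ setT _ measurableT mf).
  by rewrite preimage_setT.
by move=> x _; exact: f0.
Qed.

(** Rotation invariance of the standard Gaussian law in the plane. *)
Lemma gauss_stable a b c f : 0 <= c -> a ^+ 2 + b ^+ 2 = c ^+ 2 ->
  measurable_fun [set: R] f -> (forall x, (0 <= f x)%E) ->
  (\int[gauss]_x \int[gauss]_y f (a * x + b * y)%R = \int[gauss]_x f (c * x)%R)%E.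
Proof.
move=> c0 abc mf f0.
have m1 d e : measurable_fun [set: R] (fun y : R => d + e * y).
  by apply: measurable_funD => //; apply: measurable_funM.
have m2 d : measurable_fun [set: R] (fun y : R => d * y).
  by apply: measurable_funM.
have m3 : measurable_fun [set: R * R] (fun u : R * R => a * u.1 + b * u.2).
  by apply: measurable_funD; apply: measurable_funM.
have maff d e := measurableT_comp mf (m1 d e).
have mlin d := measurableT_comp mf (m2 d).
have mj := measurableT_comp mf m3.
have mJ : measurable_fun [set: R] (fun x => \int[gauss]_y f (a * x + b * y)%R)%E.
  by apply: (measurable_fun_fubini_tonelli_F (m2 := gauss)
    (fun u : R * R => f (a * u.1 + b * u.2))); [exact: mj|move=> u; exact: f0].
have J0 x : (0 <= \int[gauss]_y f (a * x + b * y)%R)%E.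
  by apply: integral_ge0 => y _; exact: f0.
rewrite (ge0_integral_gaussE mJ J0) (ge0_integral_gaussE (mlin c) (fun x => f0 _)).
rewrite -(ge0_integral_gauss2 c0 abc mf f0); apply: eq_integral => x _.
exact: (ge0_integral_gaussE (maff _ _) (fun y => f0 _)).
Qed.

Lemma gauss_expR_sqr s : 0 < s ->
  (\int[gauss]_x (expR ((1 - s ^- 2) / 2 * x ^+ 2))%:E = s%:E)%E.
Proof.
move=> s0; rewrite ge0_integral_gaussE; first exact: integral_gauss_expR_sqr.
  apply/measurable_EFinP; apply: measurableT_comp => //.
  by apply: measurable_funM => //; exact: measurable_funX.
by move=> x; rewrite lee_fin expR_ge0.
Qed.

Lemma gauss_expR_sqr4 :
  (\int[gauss]_x (expR (x ^+ 2 / 4))%:E = (Num.sqrt 2)%:E)%E.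
Proof.
have s0 : 0 < Num.sqrt 2 :> R by rewrite sqrtr_gt0.
rewrite -(gauss_expR_sqr s0); apply: eq_integral => x _; congr (expR _)%:E.
by rewrite sqr_sqrtr//; field.
Qed.

Lemma gauss_expR_sqr8 :
  (\int[gauss]_x (expR (x ^+ 2 / 8))%:E = (2 / Num.sqrt 3)%:E)%E.
Proof.
have s0 : 0 < 2 / Num.sqrt 3 :> R by rewrite divr_gt0// sqrtr_gt0.
rewrite -(gauss_expR_sqr s0); apply: eq_integral => x _; congr (expR _)%:E.
by rewrite expr_div_n sqr_sqrtr//; field.
Qed.

(** A Gaussian moment bound without polar coordinates:
    [|x| >= (1 - exp (- 4 x ^ 2)) / 2], and the right-hand side integrates to
    [(1 - 1 / 3) / 2]. *)
Lemma gauss_abs_ge : ((3^-1)%:E <= \int[gauss]_x `|x|%:E)%E.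
Proof.
have e3 := @gauss_expR_sqr 3^-1 ltac:(lra).
have me : measurable_fun [set: R] (fun x : R => expR (- (4 * x ^+ 2))).
  apply: measurableT_comp => //; apply: measurable_funN.
  by apply: measurable_funM => //; exact: measurable_funX.
have e3' : (\int[gauss]_x (expR (- (4 * x ^+ 2)))%:E = (3^-1)%:E)%E.
  rewrite -e3; apply: eq_integral => x _; congr (expR _)%:E; by field.
have mabs : measurable_fun [set: R] (fun x : R => `|x|).
  exact: normr_measurable.
(* integrate |x| + e / 2 >= 1 / 2, so as to stay with nonnegative functions *)
have H : ((2^-1)%:E <= \int[gauss]_x (`|x|%:E + (2^-1 * expR (- (4 * x ^+ 2)))%:E))%E.
  rewrite -[leLHS](integral_cstT gauss); apply: ge0_le_integralT.
  - by move=> x; rewrite lee_fin.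
  - exact: measurable_cst.
  - apply: emeasurable_funD; apply/measurable_EFinP; first exact: mabs.
    by apply: measurable_funM => //; exact: me.
  - move=> x; rewrite -EFinD lee_fin.
    have [x2|x2] := leP 2^-1 `|x|.
      by rewrite -[leLHS]addr0 lerD// mulr_ge0// expR_ge0.
    have h : 1 - 4 * x ^+ 2 <= expR (- (4 * x ^+ 2)).
      by have := expR_ge1Dx (- (4 * x ^+ 2)); lra.
    have : x ^+ 2 <= `|x| / 2.
      by rewrite -real_normK ?num_real// expr2 ler_wpM2l// ltW.
    have := normr_ge0 x; lra.
have mabsE : measurable_fun [set: R] (fun x : R => `|x|%:E).
  by apply/measurable_EFinP; exact: mabs.
have meE : measurable_fun [set: R] (fun x : R => (expR (- (4 * x ^+ 2)))%:E).
  by apply/measurable_EFinP; exact: me.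
have meE2 : measurable_fun [set: R]
    (fun x : R => (2^-1 * expR (- (4 * x ^+ 2)))%:E).
  by apply/measurable_EFinP; apply: measurable_funM => //; exact: me.
have e0 (x : R) : (0 <= (expR (- (4 * x ^+ 2)))%:E)%E.
  by rewrite lee_fin expR_ge0.
have e20 (x : R) : (0 <= (2^-1 * expR (- (4 * x ^+ 2)))%:E)%E.
  by rewrite lee_fin mulr_ge0// expR_ge0.
have a0 (x : R) : (0 <= `|x|%:E)%E by rewrite lee_fin.
move: H; rewrite (ge0_integralD gauss measurableT (fun x _ => a0 x) mabsE
  (fun x _ => e20 x) meE2).
have -> : (\int[gauss]_x (2^-1 * expR (- (4 * x ^+ 2)))%:E = (6^-1)%:E)%E.
  have h0 : (0 <= (2^-1 : R)%:E)%E by rewrite lee_fin.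
  transitivity ((2^-1)%:E * \int[gauss]_x (expR (- (4 * x ^+ 2)))%:E)%E.
    rewrite -(ge0_integralZl gauss measurableT meE (fun x _ => e0 x) h0).
    by apply: eq_integral => x _; rewrite EFinM.
  by rewrite e3' -EFinM; congr EFin; field.
rewrite -leeBlDr// => /(le_trans _); apply.
by rewrite -EFinB lee_fin; lra.
Qed.

End Gauss.

(** * Powers of a probability measure *)

Section TuplePower.
Context d (T : measurableType d) (R : realType).

Definition tcons n (p : T * n.-tuple T) : n.+1.-tuple T :=
  [tuple of p.1 :: p.2].

Lemma tnth_tcons0 n (p : T * n.-tuple T) : tnth (tcons p) ord0 = p.1.
Proof. by []. Qed.

Lemma tnth_tconsS n (p : T * n.-tuple T) (i : 'I_n) :
  tnth (tcons p) (lift ord0 i) = tnth p.2 i.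
Proof. exact: tnthS. Qed.

Lemma measurable_tcons n : measurable_fun setT (@tcons n).
Proof. exact: measurable_cons. Qed.

HB.instance Definition _ n := @isMeasurableFun.Build _ _ _ _ (@tcons n)
  (@measurable_tcons n).

Variable mu : probability T R.

(** Coordinates are added one at a time in front, so that integrals over the
    power are computed by recursion. *)
Fixpoint tpow n : probability (n.-tuple T) R :=
  match n with
  | 0 => dirac [tuple]
  | n.+1 => distribution (mu \x tpow n)%E (@tcons n)
  end.

Lemma integral_tpow0 (f : 0.-tuple T -> \bar R) :
  measurable_fun setT f -> (\int[tpow 0]_t f t = f [tuple])%E.
Proof. by move=> mf; rewrite integral_dirac// diracT mul1e. Qed.

Section Step.
Variables (n : nat) (f : n.+1.-tuple T -> \bar R).
Hypotheses (mf : measurable_fun setT f) (f0 : forall t, (0 <= f t)%E).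

Lemma integral_tpowS :
  (\int[tpow n.+1]_t f t = \int[mu]_x \int[tpow n]_t f (tcons (x, t)))%E.
Proof.
rewrite (@ge0_integral_distribution _ _ _ _ _ (mu \x tpow n)%E (@tcons n) f mf f0).
rewrite (fubini_tonelli1 (m1 := mu) (m2 := tpow n) (f \o @tcons n))//.
  exact: (measurableT_comp mf (@measurable_tcons n)).
by move=> p; exact: f0.
Qed.

Lemma measurable_integral_tcons :
  measurable_fun setT (fun x => \int[tpow n]_t f (tcons (x, t)))%E.
Proof.
apply: (measurable_fun_fubini_tonelli_F (m2 := tpow n) (f \o @tcons n)).
  exact: (measurableT_comp mf (@measurable_tcons n)).
by move=> p; exact: f0.
Qed.

Lemma measurable_tcons1 x : measurable_fun setT (fun t => f (tcons (x, t))).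
Proof.
apply: (measurableT_comp mf); apply: (measurableT_comp (@measurable_tcons n)).
exact: measurable_fun_pair.
Qed.

End Step.

Lemma integral_tpow_prod n (f : 'I_n -> T -> R) (M : 'I_n -> R) :
  (forall i, measurable_fun setT (f i)) -> (forall i x, 0 <= f i x) ->
  (forall i, (\int[mu]_x (f i x)%:E = (M i)%:E)%E) ->
  (\int[tpow n]_t (\prod_(i < n) f i (tnth t i))%:E = (\prod_(i < n) M i)%:E)%E.
Proof.
have mprod k (h : 'I_k -> T -> R) : (forall i, measurable_fun setT (h i)) ->
    measurable_fun setT (fun t : k.-tuple T => (\prod_(i < k) h i (tnth t i))%:E).
  move=> mh; apply/measurable_EFinP; apply: measurable_prod => i _.
  exact: (measurableT_comp (mh i) (measurable_tnth i)).
elim: n => [|n IH] in f M *; move=> mf f0 fM.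
  by rewrite integral_tpow0 ?big_ord0//; exact: mprod.
rewrite integral_tpowS; [|exact: mprod|]; last first.
  by move=> t; rewrite lee_fin prodr_ge0.
have M0 i : 0 <= M i.
  by rewrite -lee_fin -fM; apply: integral_ge0 => x _; rewrite lee_fin.
pose Mr := \prod_(i < n) M (lift ord0 i).
transitivity (\int[mu]_x (Mr%:E * (f ord0 x)%:E))%E.
  apply: eq_integral => x _.
  rewrite /Mr -(IH (fun i => f (lift ord0 i)))//.
  rewrite -ge0_integralZr//; first last.
  - by rewrite lee_fin.
  - by move=> t _; rewrite lee_fin prodr_ge0.
  - exact: (mprod n (fun i => f (lift ord0 i)) (fun i => mf _)).
  apply: eq_integral => t _; rewrite big_ord_recl tnth_tcons0 -EFinM mulrC.
  by congr (_ * _)%:E; apply: eq_bigr => i _; rewrite tnth_tconsS.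
rewrite ge0_integralZl//.
- by rewrite fM -EFinM big_ord_recl mulrC.
- exact/measurable_EFinP.
- by move=> x _; rewrite lee_fin.
- by rewrite lee_fin prodr_ge0.
Qed.

Lemma tpow_box n (A : 'I_n -> set T) : (forall i, measurable (A i)) ->
  tpow n [set t | forall i, A i (tnth t i)] = (\prod_(i < n) mu (A i))%E.
Proof.
move=> mA.
have mB : measurable [set t : n.-tuple T | forall i, A i (tnth t i)].
  rewrite (_ : mkset _ = \bigcap_(i in [set: 'I_n]) ((@tnth n T)^~ i @^-1` A i)).
    apply: fin_bigcap_measurable => // i _; rewrite -[X in measurable X]setTI.
    exact: measurable_tnth.
  by apply/seteqP; split => t /= h i; [move=> _; exact: h|exact: h].
set B := mkset _ in mB *.
have -> : tpow n B = (\int[tpow n]_t (\1_B t)%:E)%E.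
  by rewrite integral_indic// setIT.
transitivity (\int[tpow n]_t (\prod_(i < n) \1_(A i) (tnth t i))%:E)%E.
  apply: eq_integral => t _; congr EFin; rewrite indicE.
  have [/set_mem h|h] := boolP (t \in _).
    by rewrite big1// => i _; rewrite indicE mem_set.
  have /existsNP[i Ai] : ~ forall i, A i (tnth t i).
    by move=> h'; move/negP: h; apply; apply/mem_set.
  by rewrite (bigD1 i)//= indicE memNset// mul0r.
rewrite (@integral_tpow_prod n (fun i => \1_(A i)) (fun i => fine (mu (A i)))).
- rewrite -prodEFin; apply: eq_bigr => i _; rewrite fineK//.
  by apply: fin_num_measure.
- by move=> i; exact: measurable_indic.
- by move=> i x; rewrite indicE.
- by move=> i; rewrite integral_indic// setIT fineK//; apply: fin_num_measure.
Qed.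

End TuplePower.

(** * Standard Gaussian vectors *)

Section GaussVector.
Variable R : realType.
Local Notation gauss := (@gauss R).
Local Notation nu m := (tpow gauss m).
Implicit Types (m : nat) (a b c : R).

Definition tlin m a b (x y : m.-tuple R) : m.-tuple R :=
  [tuple a * tnth x i + b * tnth y i | i < m].

Definition tdot m (u : 'I_m -> R) (x : m.-tuple R) : R :=
  \sum_(i < m) u i * tnth x i.

Lemma tlin_tcons m a b (x y : R) (s t : m.-tuple R) :
  tlin a b (tcons (x, s)) (tcons (y, t)) = tcons ((a * x + b * y)%R, tlin a b s t).
Proof.
apply: eq_from_tnth => i; rewrite tnth_mktuple.
case: (unliftP ord0 i) => [j|] ->; last by rewrite !tnth_tcons0.
by rewrite !tnth_tconsS tnth_mktuple.
Qed.

Lemma tdot_tcons m (u : 'I_m.+1 -> R) (x : R) (s : m.-tuple R) :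
  tdot u (tcons (x, s)) = u ord0 * x + tdot (fun i => u (lift ord0 i)) s.
Proof.
rewrite /tdot big_ord_recl tnth_tcons0; congr (_ + _).
by apply: eq_bigr => i _; rewrite tnth_tconsS.
Qed.

Lemma tdot_tlin m (u : 'I_m -> R) a b s t :
  tdot u (tlin a b s t) = a * tdot u s + b * tdot u t.
Proof.
rewrite /tdot !mulr_sumr -big_split; apply: eq_bigr => i _ /=.
by rewrite tnth_mktuple mulrDr !(mulrCA (u i)).
Qed.

Lemma measurable_tdot m (u : 'I_m -> R) : measurable_fun setT (tdot u).
Proof.
apply: measurable_sum => i; apply: measurable_funM => //.
exact: measurable_tnth.
Qed.

Lemma measurable_tlin m a b :
  measurable_fun setT (fun p : m.-tuple R * m.-tuple R => tlin a b p.1 p.2).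
Proof.
apply/measurable_fun_tnthP => i.
rewrite (_ : _ \o _ = fun p : m.-tuple R * m.-tuple R =>
  a * tnth p.1 i + b * tnth p.2 i); last first.
  by apply/funext => p /=; rewrite tnth_mktuple.
have m1 := measurableT_comp (@measurable_tnth _ R m i)
  (@measurable_fst _ _ (m.-tuple R) (m.-tuple R)).
have m2 := measurableT_comp (@measurable_tnth _ R m i)
  (@measurable_snd _ _ (m.-tuple R) (m.-tuple R)).
by apply: measurable_funD; apply: measurable_funM.
Qed.

Section Stable.
Variables a b c : R.
Hypotheses (c0 : 0 <= c) (abc : a ^+ 2 + b ^+ 2 = c ^+ 2).

(** The planar statement [gauss_stable], applied to one coordinate after the
    other. *)
Lemma tpow_gauss_stable m (F : m.-tuple R -> \bar R) :
  measurable_fun setT F -> (forall t, (0 <= F t)%E) ->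
  (\int[nu m]_s \int[nu m]_t F (tlin a b s t) = \int[nu m]_s F (tlin c 0 s s))%E.
Proof.
elim: m => [|m IH] in F *; move=> mF F0.
  have mE (G : 0.-tuple R -> \bar R) : measurable_fun setT G.
    rewrite (_ : G = cst (G [tuple])); first exact: measurable_cst.
    by apply/funext => t; rewrite (tuple0 t).
  by rewrite !integral_tpow0//; congr F; rewrite [LHS]tuple0 [RHS]tuple0.
have mj : measurable_fun setT (fun p : m.+1.-tuple R * m.+1.-tuple R =>
    F (tlin a b p.1 p.2)).
  exact: (measurableT_comp mF (@measurable_tlin m.+1 a b)).
have mj1 s : measurable_fun setT (fun t => F (tlin a b s t)).
  by apply: (measurableT_comp mj (g := fun t => (s, t))); exact: measurable_fun_pair.
have mJ : measurable_fun setT (fun s => \int[nu m.+1]_t F (tlin a b s t))%E.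
  by apply: (measurable_fun_fubini_tonelli_F (m2 := nu m.+1)
    (fun p => F (tlin a b p.1 p.2))).
rewrite integral_tpowS//; last by move=> s; apply: integral_ge0 => t _; exact: F0.
(* joint measurability, needed to exchange the integrals over s and y *)
have m3 x : measurable_fun setT (fun p : (m.-tuple R * R) * m.-tuple R =>
    F (tcons ((a * x + b * p.1.2)%R, tlin a b p.1.1 p.2))).
  apply: (measurableT_comp mF); apply: (measurableT_comp (@measurable_tcons _ _ _)).
  apply: measurable_fun_pair.
    apply: measurable_funD => //; apply: measurable_funM => //.
    exact: (measurableT_comp measurable_snd measurable_fst).
  apply: (measurableT_comp (@measurable_tlin m a b)
    (g := fun p : (m.-tuple R * R) * m.-tuple R => (p.1.1, p.2))).
  apply: measurable_fun_pair => //.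
  exact: (measurableT_comp measurable_fst measurable_fst).
have m2 x : measurable_fun setT (fun p : m.-tuple R * R =>
    \int[nu m]_t F (tcons ((a * x + b * p.2)%R, tlin a b p.1 t)))%E.
  by apply: (measurable_fun_fubini_tonelli_F (m2 := nu m)
    (fun p : (m.-tuple R * R) * m.-tuple R =>
      F (tcons ((a * x + b * p.1.2)%R, tlin a b p.1.1 p.2)))).
pose Fc z := (\int[nu m]_s F (tcons (z, tlin c 0 s s)))%E.
have mFc' : measurable_fun setT (fun p : R * m.-tuple R =>
    F (tcons (p.1, tlin c 0 p.2 p.2))).
  apply: (measurableT_comp mF); apply: (measurableT_comp (@measurable_tcons _ _ _)).
  apply: measurable_fun_pair => //.
  apply: (measurableT_comp (@measurable_tlin m c 0)
    (g := fun p : R * m.-tuple R => (p.2, p.2))).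
  exact: measurable_fun_pair.
have mFc : measurable_fun setT Fc.
  by apply: (measurable_fun_fubini_tonelli_F (m2 := nu m)
    (fun p : R * m.-tuple R => F (tcons (p.1, tlin c 0 p.2 p.2)))).
have Fc0 z : (0 <= Fc z)%E by apply: integral_ge0.
have mtc z : measurable_fun setT (fun t : m.-tuple R => F (tcons (z, t))).
  exact: (measurable_tcons1 mF z).
transitivity (\int[gauss]_x \int[gauss]_y Fc (a * x + b * y)%R)%E.
  apply: eq_integral => x _.
  transitivity (\int[nu m]_s \int[gauss]_y \int[nu m]_t
      F (tcons ((a * x + b * y)%R, tlin a b s t)))%E.
    apply: eq_integral => s _; rewrite (integral_tpowS gauss (mj1 (tcons (x, s))) (fun t => F0 _)).
    apply: eq_integral => y _; apply: eq_integral => t _.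
    by rewrite tlin_tcons.
  transitivity (\int[gauss]_y \int[nu m]_s \int[nu m]_t
      F (tcons ((a * x + b * y)%R, tlin a b s t)))%E.
    apply: (fubini_tonelli (m1 := nu m) (m2 := gauss) (fun p : m.-tuple R * R =>
      \int[nu m]_t F (tcons ((a * x + b * p.2)%R, tlin a b p.1 t)))%E).
      exact: m2.
    by move=> p; apply: integral_ge0.
  apply: eq_integral => y _.
  exact: (IH (fun t => F (tcons ((a * x + b * y)%R, t)))).
rewrite (gauss_stable c0 abc mFc Fc0).
have mFd : measurable_fun setT (fun s : m.+1.-tuple R => F (tlin c 0 s s)).
  apply: (measurableT_comp mF).
  apply: (measurableT_comp (@measurable_tlin m.+1 c 0)
    (g := fun p : m.+1.-tuple R => (p, p))).
  exact: measurable_fun_pair.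
rewrite (integral_tpowS gauss mFd (fun s => F0 _)).
apply: eq_integral => x _; apply: eq_integral => s _.
by rewrite tlin_tcons mul0r addr0.
Qed.

End Stable.

Lemma tlin10 m (s t : m.-tuple R) : tlin 1 0 s t = s.
Proof.
by apply: eq_from_tnth => i; rewrite tnth_mktuple mul1r mul0r addr0.
Qed.

(** Stability with [a = -1], [b = 0] and [c = 1]. *)
Lemma tpow_gauss_opp m (F : m.-tuple R -> \bar R) :
  measurable_fun setT F -> (forall t, (0 <= F t)%E) ->
  (\int[nu m]_s F (tlin (-1) 0 s s) = \int[nu m]_s F s)%E.
Proof.
move=> mF F0; have e : (-1) ^+ 2 + 0 ^+ 2 = 1 ^+ 2 :> R by ring.
transitivity (\int[nu m]_s F (tlin 1 0 s s))%E; last first.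
  by apply: eq_integral => s _; rewrite tlin10.
rewrite -(tpow_gauss_stable ler01 e mF F0); apply: eq_integral => s _.
rewrite -[LHS](integral_cstT (nu m)); apply: eq_integral => t _.
by congr F; apply: eq_from_tnth => i; rewrite !tnth_mktuple !mul0r.
Qed.

(** By induction on the dimension: the coordinates after the first contribute a
    Gaussian variable independent of the first one, and rotation invariance in the
    plane merges the two. *)
Lemma tpow_gauss_dot m (u : 'I_m -> R) (f : R -> \bar R) :
  measurable_fun [set: R] f -> (forall x, (0 <= f x)%E) ->
  (\int[nu m]_s f (tdot u s) =
   \int[gauss]_x f (Num.sqrt (\sum_i u i ^+ 2) * x)%R)%E.
Proof.
elim: m => [|m IH] in u f *; move=> mf f0.
  rewrite integral_tpow0; last exact (measurableT_comp mf (measurable_tdot u)).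
  rewrite big_ord0 sqrtr0 /tdot big_ord0 -[LHS](integral_cstT gauss).
  by apply: eq_integral => x _; rewrite mul0r.
have mt : measurable_fun setT (fun s => f (tdot u s)).
  exact (measurableT_comp mf (measurable_tdot u)).
rewrite (integral_tpowS gauss mt (fun s => f0 _)).
pose c' := Num.sqrt (\sum_(i < m) u (lift ord0 i) ^+ 2).
have s0 k (v : 'I_k -> R) : 0 <= \sum_(i < k) v i ^+ 2.
  by apply: sumr_ge0 => i _; exact: sqr_ge0.
transitivity (\int[gauss]_x \int[gauss]_y f (u ord0 * x + c' * y)%R)%E.
  apply: eq_integral => x _.
  transitivity (\int[nu m]_s (f \o +%R (u ord0 * x))
      (tdot (fun i => u (lift ord0 i)) s))%E.
    by apply: eq_integral => s _; rewrite tdot_tcons.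
  have md : measurable_fun [set: R] (+%R (u ord0 * x)) by exact: measurable_funD.
  exact: (IH _ _ (measurableT_comp mf md) (fun=> f0 _)).
apply: gauss_stable => //.
by rewrite !sqr_sqrtr// big_ord_recl.
Qed.

End GaussVector.

(** * Exponential symmetrization, one row at a time *)

Section ExpMax.
Variable R : realType.

(** The default value [0] is harmless because the weights [A] are nonnegative
    throughout; it makes the maximum over the empty family meaningful. *)
Definition expmax N (A h : 'I_N -> R) : R :=
  \big[Num.max/0]_(k < N) (A k * expR (h k)).

Lemma expmax_ge0 N (A h : 'I_N -> R) : 0 <= expmax A h.
Proof. exact: bigmax_ge_id. Qed.

Lemma expmax_ub N (A h : 'I_N -> R) k : A k * expR (h k) <= expmax A h.
Proof. exact: le_bigmax. Qed.

Lemma expmax_le N (A h : 'I_N -> R) (z : R) :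
  0 <= z -> (forall k, A k * expR (h k) <= z) -> expmax A h <= z.
Proof. by move=> z0 hz; apply: bigmax_le. Qed.

(** The maximum passes under an integral although the latter may be infinite. *)
Lemma expmax_lee N (A h : 'I_N -> R) (z : \bar R) :
  (0 <= z)%E -> (forall k, ((A k * expR (h k))%:E <= z)%E) ->
  ((expmax A h)%:E <= z)%E.
Proof.
move=> z0 hz; rewrite /expmax; elim/big_ind : _ => //.
by move=> x y hx hy; rewrite maxEle; case: ifP.
Qed.

Lemma eq_expmax N (A B h l : 'I_N -> R) :
  (forall k, A k * expR (h k) = B k * expR (l k)) -> expmax A h = expmax B l.
Proof. by move=> e; apply: eq_bigr => k _. Qed.

Lemma measurable_expmax d (T : measurableType d) N (A h : 'I_N -> T -> R) :
  (forall k, measurable_fun setT (A k)) -> (forall k, measurable_fun setT (h k)) ->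
  measurable_fun setT (fun x => (expmax (A ^~ x) (h ^~ x))%:E).
Proof.
move=> mA mh; apply/measurable_EFinP; rewrite /expmax.
have mt k : measurable_fun setT (fun x => A k x * expR (h k x)).
  by apply: measurable_funM => //; exact: measurableT_comp.
elim: (index_enum _) => [|k s IH].
  by under eq_fun do rewrite big_nil; exact: measurable_cst.
under eq_fun do rewrite big_cons; exact: measurable_maxr.
Qed.

End ExpMax.

Section Rows.
Variables (R : realType) (m N : nat) (u : 'I_N -> 'I_m -> R) (b : R).
Local Notation nu := (tpow (@gauss R) m).

Hypothesis exp_b : forall k,
  ((expR b)%:E <= \int[nu]_g (expR `|tdot (u k) g|)%:E)%E.

Let mdot k : measurable_fun setT (tdot (u k)) := measurable_tdot (u k).

Let mabs k : measurable_fun setT (fun g => `|tdot (u k) g|).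
Proof. exact: (measurableT_comp (@normr_measurable _ setT) (mdot k)). Qed.

(** The factor [exp b] is absorbed by an independent copy [g'] of the row. By
    the inequality of arithmetic and geometric means,
    [exp (|s'| - |s|) <= (exp (2 |s'|) + exp (- 2 |s|)) / 2]; at a single point,
    the maxima of [A exp (2 |s|)] and [A exp (- 2 |s|)] are at most the larger
    and the smaller of the maxima of [A exp (2 s)] and [A exp (- 2 s)], and the
    last two have the same integral because the law is symmetric. *)
Lemma row_symmetrization (A : 'I_N -> R) : (forall k, 0 <= A k) ->
  (\int[nu]_g (expmax A (fun k => b - `|tdot (u k) g|)%R)%:E <=
   \int[nu]_g (expmax A (fun k => 2 * tdot (u k) g)%R)%:E)%E.
Proof.
move=> A0; pose a k := A k / 2.
have a0 k : 0 <= a k by rewrite divr_ge0.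
pose Pm g := expmax a (fun k => 2 * `|tdot (u k) g|).
pose Qm g := expmax a (fun k => - (2 * `|tdot (u k) g|)).
pose Xm g := expmax a (fun k => 2 * tdot (u k) g).
pose Ym g := expmax a (fun k => - (2 * tdot (u k) g)).
have mP : measurable_fun setT (fun g => (Pm g)%:E).
  apply: (measurable_expmax (A := fun k _ => a k)
    (h := fun k g => 2 * `|tdot (u k) g|)) => // k.
  by apply: measurable_funM => //; exact: mabs.
have mQ : measurable_fun setT (fun g => (Qm g)%:E).
  apply: (measurable_expmax (A := fun k _ => a k)
    (h := fun k g => - (2 * `|tdot (u k) g|))) => // k.
  by apply: measurable_funN; apply: measurable_funM => //; exact: mabs.
have mX : measurable_fun setT (fun g => (Xm g)%:E).
  apply: (measurable_expmax (A := fun k _ => a k)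
    (h := fun k g => 2 * tdot (u k) g)) => // k.
  by apply: measurable_funM => //; exact: mdot.
have mY : measurable_fun setT (fun g => (Ym g)%:E).
  apply: (measurable_expmax (A := fun k _ => a k)
    (h := fun k g => - (2 * tdot (u k) g))) => // k.
  by apply: measurable_funN; apply: measurable_funM => //; exact: mdot.
have P0 g : (0 <= (Pm g)%:E)%E by rewrite lee_fin expmax_ge0.
have Q0 g : (0 <= (Qm g)%:E)%E by rewrite lee_fin expmax_ge0.
have X0 g : (0 <= (Xm g)%:E)%E by rewrite lee_fin expmax_ge0.
have Y0 g : (0 <= (Ym g)%:E)%E by rewrite lee_fin expmax_ge0.
have YX : (\int[nu]_g (Ym g)%:E = \int[nu]_g (Xm g)%:E)%E.
  rewrite -(tpow_gauss_opp mX X0); apply: eq_integral => g _; congr EFin.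
  by apply: eq_expmax => k; rewrite tdot_tlin mul0r addr0 mulN1r mulrN.
have PQXY g : Pm g + Qm g <= Xm g + Ym g.
  rewrite -[leRHS]addr_max_min; apply: lerD.
    rewrite /Pm; apply: expmax_le => [|k]; first by rewrite le_max expmax_ge0.
    rewrite le_max; apply/orP; have [s0|s0] := lerP 0 (tdot (u k) g).
      by left; rewrite ?(ger0_norm s0); exact: (expmax_ub a (fun k => 2 * tdot (u k) g) k).
    right; rewrite ?(ltr0_norm s0) mulrN.
    exact: (expmax_ub a (fun k => - (2 * tdot (u k) g)) k).
  have [lo hi] : Qm g <= Xm g /\ Qm g <= Ym g.
    rewrite /Qm; split; (apply: expmax_le => [|k]; first exact: expmax_ge0);
      apply: (le_trans _ (expmax_ub _ _ k)); rewrite ler_wpM2l// ler_expR.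
      by have := ler_norm (- tdot (u k) g); rewrite normrN; lra.
    by have := ler_norm (tdot (u k) g); lra.
  by rewrite le_min lo hi.
have me k : measurable_fun setT (fun g => (expR `|tdot (u k) g|)%:E).
  apply/measurable_EFinP.
  exact: (measurableT_comp (@measurable_expR R) (mabs k)).
have mPQ g : measurable_fun setT (fun g' => (Pm g')%:E + (Qm g)%:E)%E.
  by apply: emeasurable_funD => //; exact: measurable_cst.
have PQ0 g g' : (0 <= (Pm g')%:E + (Qm g)%:E)%E by rewrite adde_ge0.
have IPQ g : (\int[nu]_g' ((Pm g')%:E + (Qm g)%:E) =
    \int[nu]_g' (Pm g')%:E + (Qm g)%:E)%E.
  rewrite (ge0_integralD nu measurableT (fun x _ => P0 x) mP (fun _ _ => Q0 g)).
    by rewrite integral_cstT.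
  exact: measurable_cst.
have mQc : measurable_fun setT (fun g => \int[nu]_g' (Pm g')%:E + (Qm g)%:E)%E.
  by apply: emeasurable_funD => //; exact: measurable_cst.
have iP0 : (0 <= \int[nu]_g' (Pm g')%:E)%E by apply: integral_ge0.
apply: (@le_trans _ _ (\int[nu]_g (\int[nu]_g' (Pm g')%:E + (Qm g)%:E))%E).
  apply: ge0_le_integralT.
  - by move=> g; rewrite lee_fin expmax_ge0.
  - apply: (measurable_expmax (A := fun k _ => A k)
      (h := fun k g => b - `|tdot (u k) g|)) => // k.
    by apply: measurable_funB => //; exact: mabs.
  - exact: mQc.
  - move=> g; apply: expmax_lee; first by rewrite adde_ge0.
    move=> k; rewrite -IPQ.
    pose C := A k * expR (- `|tdot (u k) g|).
    have C0 : (0 <= C%:E)%E by rewrite lee_fin mulr_ge0// expR_ge0.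
    apply: (@le_trans _ _ (C%:E * \int[nu]_g' (expR `|tdot (u k) g'|)%:E)%E).
      rewrite [leLHS](_ : _ = (C%:E * (expR b)%:E)%E); first exact: lee_wpmul2l.
      by rewrite -EFinM /C expRD; congr EFin; ring.
    rewrite -(ge0_integralZl nu measurableT (me k) _ C0); last first.
      by move=> x _; rewrite lee_fin expR_ge0.
    apply: ge0_le_integralT.
    + by move=> g'; rewrite mule_ge0// lee_fin expR_ge0.
    + exact: measurable_funeM.
    + exact: mPQ.
    + move=> g'; rewrite -EFinM -EFinD lee_fin.
      apply: (@le_trans _ _ (a k * expR (2 * `|tdot (u k) g'|) +
          a k * expR (- (2 * `|tdot (u k) g|)))); last first.
        by apply: lerD; exact: expmax_ub.
      rewrite /C /a; set x := `|_|; set y := `|_|.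
      have -> : expR (2 * y) = expR y ^+ 2 by rewrite expRM_natl.
      have -> : expR (- (2 * x)) = expR (- x) ^+ 2 by rewrite -mulrN expRM_natl.
      have := mulr_ge0 (A0 k) (sqr_ge0 (expR y - expR (- x))); lra.
rewrite (ge0_integralD nu measurableT (fun _ _ => iP0) (measurable_cst _)
  (fun x _ => Q0 x) mQ).
rewrite integral_cstT.
rewrite -(ge0_integralD nu measurableT (fun x _ => P0 x) mP (fun x _ => Q0 x) mQ).
apply: (@le_trans _ _ (\int[nu]_g ((Xm g)%:E + (Ym g)%:E))%E).
  apply: ge0_le_integralT.
  - by move=> g; rewrite adde_ge0.
  - exact: emeasurable_funD.
  - exact: emeasurable_funD.
  - by move=> g; rewrite -!EFinD lee_fin.
rewrite (ge0_integralD nu measurableT (fun x _ => X0 x) mX (fun x _ => Y0 x) mY).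
rewrite YX.
rewrite -(ge0_integralD nu measurableT (fun x _ => X0 x) mX (fun x _ => X0 x) mX).
apply: ge0_le_integralT.
- by move=> g; rewrite adde_ge0.
- exact: emeasurable_funD.
- apply: (measurable_expmax (A := fun k _ => A k)
    (h := fun k g => 2 * tdot (u k) g)) => // k.
  by apply: measurable_funM => //; exact: mdot.
- move=> g; rewrite -EFinD lee_fin.
  suff : Xm g <= expmax A (fun k => 2 * tdot (u k) g) / 2 by lra.
  rewrite /Xm; apply: expmax_le => [|k]; first by rewrite divr_ge0// expmax_ge0.
  rewrite /a mulrAC ler_pM2r ?invr_gt0//.
  exact: (expmax_ub A (fun k => 2 * tdot (u k) g) k).
Qed.

(** Replacing the rows successively collects the independent copies into
    [g_1 + ... + g_n], which is [sqrt n] times a single Gaussian vector. *)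
Lemma rows_symmetrization n (A : 'I_N -> R) : (forall k, 0 <= A k) ->
  (\int[tpow nu n]_t
     (expmax A (fun k => \sum_(i < n) (b - `|tdot (u k) (tnth t i)|))%R)%:E <=
   \int[nu]_g (expmax A (fun k => 2 * (Num.sqrt n%:R * tdot (u k) g))%R)%:E)%E.
Proof.
have mrows j (B : 'I_N -> R) : measurable_fun setT (fun t : j.-tuple (m.-tuple R) =>
    (expmax B (fun k => \sum_(i < j) (b - `|tdot (u k) (tnth t i)|)))%:E).
  apply: (measurable_expmax (A := fun k _ => B k)
    (h := fun k (t : j.-tuple (m.-tuple R)) =>
      \sum_(i < j) (b - `|tdot (u k) (tnth t i)|))) => // k.
  apply: measurable_sum => i; apply: measurable_funB => //.
  exact: (measurableT_comp (mabs k) (measurable_tnth i)).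
elim: n => [|n IH] in A *; move=> A0.
  rewrite integral_tpow0// -[leLHS](integral_cstT nu) le_eqVlt; apply/orP; left.
  apply/eqP; apply: eq_integral => g _; congr EFin; apply: eq_expmax => k.
  by rewrite big_ord0 sqrtr0 mul0r mulr0.
have pos j (B h : 'I_j -> R) : (0 <= (expmax B h)%:E)%E by rewrite lee_fin expmax_ge0.
rewrite (integral_tpowS nu (mrows _ _) (fun t => pos _ _ _)).
pose J (g0 g : m.-tuple R) := (expmax A (fun k =>
  (b - `|tdot (u k) g0|) + 2 * (Num.sqrt n%:R * tdot (u k) g)))%:E.
have mJ : measurable_fun setT (fun p : m.-tuple R * m.-tuple R => J p.1 p.2).
  apply: (measurable_expmax (A := fun k _ => A k)
    (h := fun k (p : m.-tuple R * m.-tuple R) =>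
      (b - `|tdot (u k) p.1|) + 2 * (Num.sqrt n%:R * tdot (u k) p.2))) => // k.
  apply: measurable_funD.
    by apply: measurable_funB => //; exact (measurableT_comp (mabs k) measurable_fst).
  do 2 apply: measurable_funM => //.
  exact (measurableT_comp (mdot k) measurable_snd).
apply: (@le_trans _ _ (\int[nu]_g0 \int[nu]_g J g0 g)%E).
  apply: ge0_le_integralT.
  - by move=> g0; apply: integral_ge0 => t _; exact: pos.
  - exact: (measurable_integral_tcons nu (mrows _ _) (fun t => pos _ _ _)).
  - by apply: (measurable_fun_fubini_tonelli_F (m2 := nu)
      (fun p : m.-tuple R * m.-tuple R => J p.1 p.2)) => // p; exact: pos.
  move=> g0; pose B k := A k * expR (b - `|tdot (u k) g0|).
  have B0 k : 0 <= B k by rewrite mulr_ge0// expR_ge0.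
  have := IH B B0.
  rewrite [X in (_ <= X)%E -> _](_ : _ = \int[nu]_g J g0 g)%E; last first.
    apply: eq_integral => g _; congr EFin; apply: eq_expmax => k.
    by rewrite /B -mulrA -expRD.
  apply: le_trans; rewrite le_eqVlt; apply/orP; left; apply/eqP.
  apply: eq_integral => t _; congr EFin; apply: eq_expmax => k.
  rewrite /B -mulrA -expRD big_ord_recl tnth_tcons0; congr (_ * expR (_ + _)).
  by apply: eq_bigr => i _; rewrite tnth_tconsS.
have -> : (\int[nu]_g0 \int[nu]_g J g0 g = \int[nu]_g \int[nu]_g0 J g0 g)%E.
  apply: (fubini_tonelli (m1 := nu) (m2 := nu)
    (fun p : m.-tuple R * m.-tuple R => J p.1 p.2)); first exact: mJ.
  by move=> p; exact: pos.
pose F g := (expmax A (fun k => 2 * tdot (u k) g))%:E.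
have mF : measurable_fun setT F.
  apply: (measurable_expmax (A := fun k _ => A k)
    (h := fun k g => 2 * tdot (u k) g)) => // k.
  by apply: measurable_funM => //; exact: mdot.
have F0 g : (0 <= F g)%E by exact: pos.
have e : Num.sqrt n%:R ^+ 2 + 1 ^+ 2 = Num.sqrt n.+1%:R ^+ 2 :> R.
  by rewrite !sqr_sqrtr// expr1n natr1.
have := tpow_gauss_stable (sqrtr_ge0 n.+1%:R) e mF F0 => st.
rewrite [leRHS](_ : _ = \int[nu]_s \int[nu]_t F (tlin (Num.sqrt n%:R) 1 s t))%E; last first.
  rewrite st; apply: eq_integral => g _; congr EFin; apply: eq_expmax => k.
  by rewrite tdot_tlin mul0r addr0.
apply: ge0_le_integralT.
- by move=> g; apply: integral_ge0 => g0 _; exact: pos.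
- by apply: (measurable_fun_fubini_tonelli_G (m1 := nu)
    (fun p : m.-tuple R * m.-tuple R => J p.1 p.2)) => // p; exact: pos.
- apply: (measurable_fun_fubini_tonelli_F (m2 := nu)
    (fun p : m.-tuple R * m.-tuple R => F (tlin (Num.sqrt n%:R) 1 p.1 p.2))).
    exact (measurableT_comp mF (@measurable_tlin _ m (Num.sqrt n%:R) 1)).
  by move=> p; exact: pos.
move=> g; pose B k := A k * expR (2 * (Num.sqrt n%:R * tdot (u k) g)).
have B0 k : 0 <= B k by rewrite mulr_ge0// expR_ge0.
have := row_symmetrization B0.
rewrite [X in (X <= _)%E -> _](_ : _ = \int[nu]_g0 J g0 g)%E; last first.
  apply: eq_integral => g0 _; congr EFin; apply: eq_expmax => k.
  by rewrite /B -mulrA -expRD addrC.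
rewrite [X in (_ <= X)%E -> _](_ : _ =
    \int[nu]_g0 F (tlin (Num.sqrt n%:R) 1 g g0))%E; last first.
  apply: eq_integral => g0 _; congr EFin; apply: eq_expmax => k.
  by rewrite /B -mulrA -expRD tdot_tlin mul1r mulrDr.
by apply.
Qed.

End Rows.

(** * The escape estimate for finitely many vectors *)

Section Escape.
Variable R : realType.
Implicit Types (m n N : nat) (delta : R).

(** Replacing the equation [tdot (u k) (tnth t i) = 0] by an open condition makes
    it possible to move [u k] to a rational vector; the bound [1] on the sum
    costs a factor [exp 1] in Markov's inequality. *)
Definition near_kernel n m N (u : 'I_N -> 'I_m -> R) :
    set (n.-tuple (m.-tuple R)) :=
  [set t | exists k, \sum_(i < n) `|tdot (u k) (tnth t i)| < 1].
Arguments near_kernel n {m N} u.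

Lemma measurable_near_kernel n m N (u : 'I_N -> 'I_m -> R) :
  measurable (near_kernel n u).
Proof.
have mabs k : measurable_fun setT (fun g => `|tdot (u k) g|).
  exact: (measurableT_comp (@normr_measurable _ setT) (measurable_tdot (u k))).
have msum k : measurable_fun setT (fun t : n.-tuple (m.-tuple R) =>
    \sum_(i < n) `|tdot (u k) (tnth t i)|).
  apply: measurable_sum => i.
  exact: (measurableT_comp (mabs k) (measurable_tnth i)).
rewrite (_ : near_kernel n u =
    \bigcup_(k in [set: 'I_N]) ((fun t : n.-tuple (m.-tuple R) =>
      \sum_(i < n) `|tdot (u k) (tnth t i)|) @^-1` [set x | x < 1])).
  apply: fin_bigcup_measurable => // k _; rewrite -[X in measurable X]setTI.
  by apply: (msum k) => //; rewrite -set_itvNyo; exact: measurable_itv.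
by apply/seteqP; split => t /=; [case=> k hk; exists k|case=> k _ hk; exists k].
Qed.

Lemma expR_le_1D2 (t : R) : 0 <= t -> t <= 2^-1 -> expR t <= 1 + 2 * t.
Proof.
move=> t0 t2; have h := expR_ge1Dx (- t).
have e0 := expR_gt0 (- t).
have : expR t * expR (- t) = 1 by rewrite expRN divff// gt_eqF// expR_gt0.
have := expR_gt0 t; nra.
Qed.

(** [exp |c x| >= 1 + |c x|], and the first absolute moment is at least [1 / 3]. *)
Lemma expR_dot_ge m (u : 'I_m -> R) delta : 0 <= delta -> delta <= 3 ->
  delta ^+ 2 <= \sum_j u j ^+ 2 ->
  ((expR (delta / 6))%:E <=
   \int[tpow (@gauss R) m]_g (expR `|tdot u g|)%:E)%E.
Proof.
move=> d0 d3 du; set c := Num.sqrt (\sum_j u j ^+ 2).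
have dc : delta <= c by rewrite -(ger0_norm d0) -sqrtr_sqr ler_wsqrtr.
have mabs : measurable_fun [set: R] (fun x : R => `|x|) by exact: normr_measurable.
have mabsE : measurable_fun [set: R] (fun x : R => `|x|%:E).
  by apply/measurable_EFinP; exact: mabs.
have me : measurable_fun [set: R] (fun x : R => (expR `|x|)%:E).
  by apply/measurable_EFinP; apply: measurableT_comp.
rewrite (tpow_gauss_dot u me (fun x => ltac:(by rewrite lee_fin expR_ge0))) -/c.
have mc : measurable_fun [set: R] (fun x : R => (expR `|c * x|)%:E).
  by apply: (measurableT_comp me); apply: measurable_funM.
have mda : measurable_fun [set: R] (fun x : R => (delta%:E * `|x|%:E)%E).
  exact: measurable_funeM.
have d0E : (0 <= delta%:E)%E by rewrite lee_fin.
apply: (@le_trans _ _ (\int[@gauss R]_x (1 + delta%:E * `|x|%:E))%E); last first.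
  apply: ge0_le_integralT.
  - by move=> x; rewrite adde_ge0// mule_ge0.
  - by apply: emeasurable_funD => //; exact: measurable_cst.
  - exact: mc.
  - move=> x; rewrite -EFinM -EFinD lee_fin.
    apply: le_trans (expR_ge1Dx _); rewrite lerD2l normrM ler_wpM2r//.
    by rewrite (le_trans dc)// ler_norm.
have a0 (x : R) : (0 <= delta%:E * `|x|%:E)%E by rewrite mule_ge0// lee_fin.
rewrite (ge0_integralD (@gauss R) measurableT (fun _ _ => lee01)
  (measurable_cst _) (fun x _ => a0 x) mda) integral_cstT.
rewrite (ge0_integralZl (@gauss R) measurableT mabsE (fun x _ => abse_ge0 x%:E) d0E).
apply: (@le_trans _ _ (1 + delta%:E * (3^-1)%:E)%E); last first.
  by rewrite leeD2l// lee_wpmul2l// gauss_abs_ge.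
rewrite -EFinM -EFinD lee_fin (le_trans (expR_le_1D2 _ _))//; lra.
Qed.

(** If the linear form [2 sqrt n <u, g>] is dominated, uniformly in [u], by a sum
    of functions of single coordinates, then its exponential has a maximum of
    controlled expectation, and Markov's inequality applies to the symmetrized
    rows. *)
Lemma escape_bound m n N (u : 'I_N -> 'I_m -> R) delta (psi : 'I_m -> R -> R)
    (M : 'I_m -> R) (K : R) :
  0 <= delta -> delta <= 3 ->
  (forall k, delta ^+ 2 <= \sum_j u k j ^+ 2) ->
  (forall j, measurable_fun setT (psi j)) ->
  (forall j, (\int[@gauss R]_x (expR (psi j x))%:E <= (M j)%:E)%E) ->
  (forall k g, 2 * (Num.sqrt n%:R * tdot (u k) g) <=
     K + \sum_j psi j (tnth g j)) ->
  (tpow (tpow (@gauss R) m) n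
     (near_kernel n u) <=
   (expR (1 - n%:R * (delta / 6) + K) * \prod_j M j)%:E)%E.
Proof.
move=> d0 d3 du mpsi hM hK; set nu := tpow _ m; set b := delta / 6.
have mdot k : measurable_fun setT (tdot (u k)) := measurable_tdot (u k).
have mabs k : measurable_fun setT (fun g => `|tdot (u k) g|).
  exact: (measurableT_comp (@normr_measurable _ setT) (mdot k)).
set E := near_kernel n u.
have mE : measurable E by exact: measurable_near_kernel.
pose ell t := expmax (fun _ : 'I_N => 1)
  (fun k => \sum_(i < n) (b - `|tdot (u k) (tnth t i)|)).
have mell : measurable_fun setT (fun t => (ell t)%:E).
  apply: (measurable_expmax (A := fun _ _ => 1)
    (h := fun k (t : n.-tuple (m.-tuple R)) =>
      \sum_(i < n) (b - `|tdot (u k) (tnth t i)|))) => // k.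
  apply: measurable_sum => i; apply: measurable_funB => //.
  exact: (measurableT_comp (mabs k) (measurable_tnth i)).
have ell0 t : (0 <= (ell t)%:E)%E by rewrite lee_fin expmax_ge0.
have c0 : (0 <= (expR (1 - n%:R * b))%:E)%E by rewrite lee_fin expR_ge0.
have -> : tpow nu n E = (\int[tpow nu n]_t (\1_E t)%:E)%E.
  by rewrite integral_indic// setIT.
apply: (@le_trans _ _ (\int[tpow nu n]_t ((expR (1 - n%:R * b))%:E * (ell t)%:E))%E).
  apply: ge0_le_integralT.
  - by move=> t; rewrite lee_fin indicE.
  - by apply/measurable_EFinP; exact: measurable_indic.
  - exact: measurable_funeM.
  move=> t; rewrite indicE; have [/set_mem[k hk]|_] := boolP (t \in E); last first.
    by rewrite mule_ge0.
  rewrite -EFinM lee_fin; apply: (@le_trans _ _ (expR (1 - n%:R * b) *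
      (1 * expR (\sum_(i < n) (b - `|tdot (u k) (tnth t i)|))))).
    rewrite mul1r -expRD -[X in X <= _]expR0 ler_expR sumrB sumr_const card_ord.
    rewrite mulr_natl; lra.
  rewrite ler_wpM2l ?expR_ge0//.
  exact: (expmax_ub (fun=> 1) (fun k => \sum_(i < n) (b - `|tdot (u k) (tnth t i)|))).
rewrite (ge0_integralZl (tpow nu n) measurableT mell (fun t _ => ell0 t) c0).
rewrite (expRD (1 - n%:R * b) K) -mulrA EFinM lee_wpmul2l//.
apply: le_trans (rows_symmetrization (fun k => expR_dot_ge d0 d3 (du k)) n
  (fun=> ler01)) _.
have I0 j : (0 <= \int[@gauss R]_x (expR (psi j x))%:E)%E.
  by apply: integral_ge0 => x _; rewrite lee_fin expR_ge0.
have Ifin j : (\int[@gauss R]_x (expR (psi j x))%:E)%E \is a fin_num.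
  by rewrite ge0_fin_numE// (le_lt_trans (hM j))// ltry.
have mexp j : measurable_fun setT (fun x => expR (psi j x)).
  by apply: measurableT_comp => //; exact: mpsi.
have mprod : measurable_fun setT (fun g : m.-tuple R =>
    (\prod_j expR (psi j (tnth g j)))%:E).
  apply/measurable_EFinP; apply: measurable_prod => j _.
  exact: (measurableT_comp (mexp j) (measurable_tnth j)).
have p0 (g : m.-tuple R) : (0 <= (\prod_j expR (psi j (tnth g j)))%:E)%E.
  by rewrite lee_fin prodr_ge0// => j _; exact: expR_ge0.
have eK0 : (0 <= (expR K)%:E)%E by rewrite lee_fin expR_ge0.
apply: (@le_trans _ _ (\int[nu]_g ((expR K)%:E *
    (\prod_j expR (psi j (tnth g j)))%:E))%E).
  apply: ge0_le_integralT.
  - by move=> g; rewrite lee_fin expmax_ge0.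
  - apply: (measurable_expmax (A := fun _ _ => 1)
      (h := fun k g => 2 * (Num.sqrt n%:R * tdot (u k) g))) => // k.
    by do 2 apply: measurable_funM => //; exact: mdot.
  - exact: measurable_funeM.
  move=> g; rewrite -EFinM lee_fin -expR_sum -expRD.
  by apply: expmax_le => [|k]; rewrite ?expR_ge0// mul1r ler_expR.
rewrite (ge0_integralZl nu measurableT mprod (fun g _ => p0 g) eK0).
rewrite EFinM lee_wpmul2l//.
rewrite (@integral_tpow_prod _ _ _ (@gauss R) m (fun j x => expR (psi j x))
  (fun j => fine (\int[@gauss R]_x (expR (psi j x))%:E)%E)).
- rewrite lee_fin; apply: ler_prod => j _.
  by rewrite fine_ge0//= -lee_fin fineK.
- exact: mexp.
- by move=> j x; exact: expR_ge0.
- by move=> j; rewrite fineK.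
Qed.

End Escape.
Arguments near_kernel {R} n {m N} u.
Arguments measurable_near_kernel {R} n {m N} u.

(** * Leading coordinates and tail coordinates *)

Section HeadTail.
Variable R : realType.

Lemma head_count m (k : R) : 0 <= k -> \sum_(j < m | j.+1%:R < k) 1 <= k.
Proof.
move=> k0; elim: m => [|m IH]; first by rewrite big_ord0.
have [mk|mk] := ltP m.+1%:R k; last first.
  by rewrite big_mkcond big_ord_recr/= ltNge mk/= addr0 -big_mkcond.
apply: le_trans (ltW mk); rewrite big_mkcond.
apply: (@le_trans _ _ (\sum_(j < m.+1) 1)).
  by apply: ler_sum => j _; case: ifP.
by rewrite sumr_const card_ord.
Qed.

(** The first [k] coordinates are compared with the quadratic form of [u], which
    costs a bounded factor for each of them; only the tail coordinates need the
    information on [u] that is specific to the ellipsoid. *)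
Lemma escape_tail m n N (u : 'I_N -> 'I_m -> R) (delta k tau kappa : R)
    (psi : 'I_m -> R -> R) (tauj : 'I_m -> R) (kap : 'I_N -> 'I_m -> R) :
  0 <= delta -> delta <= 3 -> 0 <= k ->
  (forall i, delta ^+ 2 <= \sum_j u i j ^+ 2 <= (2 * delta) ^+ 2) ->
  (forall j, measurable_fun setT (psi j)) ->
  (forall j : 'I_m, k <= j.+1%:R ->
     (\int[@gauss R]_x (expR (psi j x))%:E <= (expR (tauj j))%:E)%E) ->
  (forall i (j : 'I_m) x, k <= j.+1%:R ->
     2 * (Num.sqrt n%:R * u i j) * x <=
     8 * (Num.sqrt n%:R * u i j) ^+ 2 + psi j x + kap i j) ->
  \sum_(j < m | k <= j.+1%:R) tauj j <= tau ->
  (forall i, \sum_(j < m | k <= j.+1%:R) kap i j <= kappa) ->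
  (tpow (tpow (@gauss R) m) n
     (near_kernel n u) <=
   (expR (1 - n%:R * (delta / 6) + (32 * n%:R * delta ^+ 2 + kappa) +
          (4 / 25 * k + tau)))%:E)%E.
Proof.
move=> d0 d3 k0 du mpsi hpsi hdom htau hkap.
pose psi' (j : 'I_m) x := if j.+1%:R < k then x ^+ 2 / 8 else psi j x.
pose mu j := if (j : 'I_m).+1%:R < k then 4 / 25 else tauj j.
have bound := @escape_bound R m n N u delta psi' (fun j => expR (mu j))
  (32 * n%:R * delta ^+ 2 + kappa) d0 d3.
apply: le_trans (bound _ _ _ _) _.
- by move=> i; case/andP: (du i).
- move=> j; rewrite /psi'; case: (_ < k); last exact: mpsi.
  by apply: measurable_funM => //; exact: measurable_funX.
- move=> j; rewrite /psi' /mu; case: (ltP j.+1%:R k) => jk; last exact: hpsi.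
  (* 2 / sqrt 3 <= 1 + 4 / 25 <= exp (4 / 25) *)
  rewrite gauss_expR_sqr8 lee_fin; apply: le_trans (expR_ge1Dx _).
  have s3 : 0 < Num.sqrt 3 :> R by rewrite sqrtr_gt0.
  have s32 : Num.sqrt 3 ^+ 2 = 3 :> R by rewrite sqr_sqrtr.
  by rewrite ler_pdivrMr//; nra.
- move=> i g; set w := fun j => Num.sqrt n%:R * u i j.
  have wn j : w j ^+ 2 = n%:R * u i j ^+ 2 by rewrite exprMn sqr_sqrtr.
  have -> : 2 * (Num.sqrt n%:R * tdot (u i) g) = \sum_j 2 * w j * tnth g j.
    by rewrite /tdot !mulr_sumr; apply: eq_bigr => j _; rewrite /w !mulrA.
  (* 8 w ^ 2 - 2 w x + x ^ 2 / 8 is a square *)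
  apply: (@le_trans _ _ (\sum_j (8 * w j ^+ 2 + psi' j (tnth g j) +
      (if k <= j.+1%:R then kap i j else 0)))).
    apply: ler_sum => j _; rewrite /psi'; case: (leP k j.+1%:R) => jk; first exact: hdom.
    by have := sqr_ge0 (w j - tnth g j / 8); lra.
  have quad : \sum_j 8 * w j ^+ 2 <= 32 * n%:R * delta ^+ 2.
    under eq_bigr do rewrite wn.
    rewrite -!mulr_sumr; have /andP[_] := du i.
    have n0 : 0 <= n%:R :> R by [].
    by move=> /(ler_wpM2l n0); lra.
  by rewrite !big_split/= -big_mkcond/=; have := hkap i; lra.
(* the factors of the first coordinates are counted: there are at most k *)
- rewrite -expR_sum -expRD lee_fin ler_expR lerD2l.
  rewrite (bigID (fun j : 'I_m => j.+1%:R < k))/=.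
  have -> : \sum_(j < m | j.+1%:R < k) mu j = 4 / 25 * \sum_(j < m | j.+1%:R < k) 1.
    by rewrite mulr_sumr; apply: eq_bigr => j jk; rewrite /mu jk mulr1.
  rewrite lerD ?ler_wpM2l ?head_count//; try lra.
  rewrite (eq_big (fun j : 'I_m => k <= j.+1%:R) tauj)//.
    by move=> j; rewrite -leNgt.
  by move=> j /negbTE jk; rewrite /mu jk.
Qed.

End HeadTail.

(** * The tail estimate for the octahedral ellipsoid *)

Section EscapeOne.
Variable R : realType.
Local Notation delta := (384^-1 : R).

Lemma sum_inv_sqr_le m : \sum_(j < m) (j.+1%:R ^+ 2)^-1 <= 2 :> R.
Proof.
suff h n : \sum_(j < n.+1) (j.+1%:R ^+ 2)^-1 <= 2 - n.+1%:R^-1 :> R.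
  case: m => [|m]; first by rewrite big_ord0.
  apply: le_trans (h m) _.
  by rewrite lerBlDr lerDl invr_ge0.
elim: n => [|n IH]; first by by rewrite big_ord1 expr1n invr1; lra.
rewrite big_ord_recr/=; set a : R := n.+1%:R in IH *.
have a0 : 0 < a by [].
have -> : n.+2%:R = a + 1 :> R by rewrite /a -natr1.
apply: le_trans (lerD IH (lexx _)) _.
rewrite -subr_ge0.
have -> : 2 - (a + 1)^-1 - (2 - a^-1 + ((a + 1) ^+ 2)^-1) = (a * (a + 1) ^+ 2)^-1.
  by field; rewrite !gt_eqF// addr_gt0.
by rewrite invr_ge0 mulr_ge0 ?sqr_ge0// ltW.
Qed.

(** Below the threshold [t] the left-hand side is at most [2 |w| t]; beyond it,
    completing the square around [(|x| - t) / 8] leaves an excess of at most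
    [(x ^ 2 - t ^ 2) / 8]. *)
Lemma threshold_le (w x t : R) : 0 <= t ->
  2 * w * x <= 8 * w ^+ 2 + Num.max 0 ((x ^+ 2 - t ^+ 2) / 8) + 2 * `|w| * t.
Proof.
move=> t0; set M := Num.max _ _.
have M0 : 0 <= M by rewrite le_max lexx.
have M1 : (x ^+ 2 - t ^+ 2) / 8 <= M by rewrite le_max lexx orbT.
have wx : w * x <= `|w| * `|x| by rewrite -normrM ler_norm.
have w2 : w ^+ 2 = `|w| ^+ 2 by rewrite real_normK ?num_real.
have x2 : x ^+ 2 = `|x| ^+ 2 by rewrite real_normK ?num_real.
rewrite x2 in M1; rewrite w2; have v0 := normr_ge0 w; have y0 := normr_ge0 x.
set v := `|w| in wx v0 *; set y := `|x| in wx M1 y0 *.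
have [yt|ty] := leP y t.
  by have := ler_wpM2l v0 yt; have := sqr_ge0 v; lra.
have h1 := sqr_ge0 (v - (y - t) / 8).
have h2 : 0 <= (y - t) * t by rewrite mulr_ge0// subr_ge0 ltW.
nra.
Qed.

(** With [t ^ 2 = 16 (ln a + 1)], the excess beyond the threshold has an
    exponential moment [1 + O (a ^ -2)], which is summable over [a = j + 1]. This
    is the origin of the factor [sqrt (log j + 1)]. *)
Lemma gauss_threshold (a : R) : 1 <= a ->
  (\int[@gauss R]_x
     (expR (Num.max 0 ((x ^+ 2 - (4 * Num.sqrt (ln a + 1)) ^+ 2) / 8)))%:E <=
   (expR (3 / 8 * (a ^+ 2)^-1))%:E)%E.
Proof.
move=> a1; have a0 : 0 < a by rewrite (lt_le_trans ltr01).
set t2 := (_ * _) ^+ 2.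
have t2E : t2 = 16 * (ln a + 1).
  by rewrite /t2 exprMn sqr_sqrtr ?addr_ge0 ?ln_ge0//; lra.
pose e := expR (- (t2 / 8)).
have e_le : e <= (a ^+ 2)^-1 / 4.
  have -> : e = (expR (ln a + 1) ^+ 2)^-1.
    by rewrite /e t2E -expRM_natl -expRN; congr expR; field.
  have E2 : 2 * a <= expR (ln a + 1).
    rewrite expRD lnK ?posrE// mulrC ler_pM2l//.
    by have := expR_ge1Dx (1 : R); lra.
  have -> : (a ^+ 2)^-1 / 4 = ((2 * a) ^+ 2)^-1 by field; rewrite gt_eqF.
  rewrite lef_pV2 ?posrE ?exprn_gt0 ?mulr_gt0 ?expR_gt0//.
  by rewrite ler_sqr// ?nnegrE ?expR_ge0// mulr_ge0// ltW.
have msq : measurable_fun [set: R] (fun x : R => x ^+ 2) by exact: measurable_funX.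
have m4 : measurable_fun [set: R] (fun x : R => (expR (x ^+ 2 / 4))%:E).
  by apply/measurable_EFinP; apply: measurableT_comp => //; apply: measurable_funM.
have e40 (x : R) : (0 <= (expR (x ^+ 2 / 4))%:E)%E by rewrite lee_fin expR_ge0.
have e0 : (0 <= e%:E)%E by rewrite lee_fin expR_ge0.
have me4 : measurable_fun [set: R] (fun x : R => e%:E * (expR (x ^+ 2 / 4))%:E)%E.
  exact: measurable_funeM.
apply: (@le_trans _ _ (\int[@gauss R]_x (1 + e%:E * (expR (x ^+ 2 / 4))%:E))%E).
  apply: ge0_le_integralT.
  - by move=> x; rewrite lee_fin expR_ge0.
  - apply/measurable_EFinP; apply: measurableT_comp => //.
    apply: measurable_maxr => //; apply: measurable_funM => //.
    exact: measurable_funB.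
  - by apply: emeasurable_funD => //; exact: measurable_cst.
  move=> x; rewrite -EFinM -EFinD lee_fin /e -expRD maxEle; case: ifP => h.
    rewrite (@le_trans _ _ (expR (- (t2 / 8) + x ^+ 2 / 4)))// ?lerDr//.
    by rewrite ler_expR; have := sqr_ge0 x; lra.
  by rewrite expR0 lerDl expR_ge0.
rewrite (ge0_integralD (@gauss R) measurableT (fun _ _ => lee01)
  (measurable_cst _) (fun x _ => mule_ge0 e0 (e40 x)) me4) integral_cstT.
rewrite (ge0_integralZl (@gauss R) measurableT m4 (fun x _ => e40 x) e0).
rewrite gauss_expR_sqr4 -EFinM -EFinD lee_fin; apply: le_trans (expR_ge1Dx _).
rewrite lerD2l.
have s2 : Num.sqrt 2 <= 3 / 2 :> R.
  have s0 : 0 <= Num.sqrt 2 :> R by rewrite sqrtr_ge0.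
  have s22 : Num.sqrt 2 ^+ 2 = 2 :> R by rewrite sqr_sqrtr.
  by nra.
apply: (@le_trans _ _ ((a ^+ 2)^-1 / 4 * (3 / 2))); last by lra.
by apply: ler_pM => //; rewrite ?sqrtr_ge0// expR_ge0.
Qed.

Lemma escape_one m n N (u : 'I_N -> 'I_m -> R) (sigma : 'I_m -> R) (k S : R) :
  (0 < n)%N -> (forall j, 0 < sigma j) -> 0 < S -> k = delta / 8 * n%:R ->
  (forall j : 'I_m, k <= j.+1%:R -> sigma j * Num.sqrt (ln j.+1%:R + 1) <= S) ->
  (forall i, delta ^+ 2 <= \sum_j u i j ^+ 2 <= (2 * delta) ^+ 2) ->
  (forall i, \sum_j `|u i j| / sigma j <=
     2 * delta / (960 * (Num.sqrt n%:R)^-1 * S)) ->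
  (tpow (tpow (@gauss R) m) n
     (near_kernel n u) <=
   (expR (2 - delta / 24 * n%:R))%:E)%E.
Proof.
move=> n0 sig0 S0 kE hS du uN.
pose t (j : 'I_m) := 4 * Num.sqrt (ln j.+1%:R + 1) : R.
pose sn := Num.sqrt n%:R : R.
have sn0 : 0 < sn by rewrite sqrtr_gt0 ltr0n.
have sn2 : sn ^+ 2 = n%:R by rewrite sqr_sqrtr.
have k0 : 0 <= k.
  by rewrite kE; apply: mulr_ge0; [lra|exact: ler0n].
apply: le_trans (@escape_tail R m n N u delta k (3 / 4) (delta / 60 * n%:R)
  (fun j x => Num.max 0 ((x ^+ 2 - t j ^+ 2) / 8))
  (fun j => 3 / 8 * (j.+1%:R ^+ 2)^-1)
  (fun i j => 2 * `|sn * u i j| * t j) _ _ _ du _ _ _ _ _) _.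
- by lra.
- by lra.
- exact: k0.
- move=> j; apply: measurable_maxr => //; apply: measurable_funM => //.
  by apply: measurable_funB => //; exact: measurable_funX.
- by move=> j _; apply: gauss_threshold; rewrite ler1n.
- by move=> i j x _; apply: threshold_le; rewrite mulr_ge0// sqrtr_ge0.
- apply: (@le_trans _ _ (\sum_(j < m) 3 / 8 * (j.+1%:R ^+ 2)^-1)).
    rewrite big_mkcond; apply: ler_sum => j _; case: ifP => _; first exact: lexx.
    by apply: mulr_ge0; [lra|rewrite invr_ge0 sqr_ge0].
  rewrite -mulr_sumr; have := sum_inv_sqr_le m; lra.
- move=> i; apply: (@le_trans _ _ (\sum_j 8 * sn * S * (`|u i j| / sigma j))).
    rewrite big_mkcond; apply: ler_sum => j _; case: ifP => jk; last first.
      by rewrite !mulr_ge0// ?invr_ge0 ltW.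
    have sj := hS j jk; rewrite normrM (gtr0_norm sn0) /t.
    have -> : 2 * (sn * `|u i j|) * (4 * Num.sqrt (ln j.+1%:R + 1)) =
        8 * sn * (sigma j * Num.sqrt (ln j.+1%:R + 1)) * (`|u i j| / sigma j).
      by field; rewrite gt_eqF.
    rewrite ler_wpM2r ?divr_ge0 ?(ltW (sig0 j))// ler_wpM2l//.
    by rewrite mulr_ge0// ltW.
  rewrite -mulr_sumr.
  have c0 : 0 <= 8 * sn * S by rewrite !mulr_ge0// ltW.
  apply: le_trans (ler_wpM2l c0 (uN i)) _.
  rewrite -/sn -sn2 le_eqVlt; apply/orP; left; apply/eqP.
  by field; rewrite !gt_eqF.
(* 1 / 6 - 1 / 12 - 1 / 60 - 1 / 50 > 1 / 24, the terms coming from the gain, the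
   quadratic form, the thresholds and the first coordinates *)
rewrite lee_fin ler_expR kE.
have : 0 <= n%:R :> R by [].
by lra.
Qed.

End EscapeOne.

(** * The tail estimate for a finite conjugate exponent *)

Section EscapeGt1.
Variable R : realType.
Local Notation delta := (384^-1 : R).

(** This is [y <= exp (y ^ 2 / 2)], raised to the power [q]; the normalization by
    [sqrt q] makes the right-hand side independent of [q]. *)
Lemma powR_le_expR_sqr8 (q x : R) : 1 <= q ->
  (`|x| / (2 * Num.sqrt q)) `^ q <= expR (x ^+ 2 / 8).
Proof.
move=> q1; have q0 : 0 < q by lra.
have sq0 : 0 < Num.sqrt q by rewrite sqrtr_gt0.
set y := `|x| / _.
have y0 : 0 <= y by rewrite divr_ge0// mulr_ge0// ltW.
have -> : x ^+ 2 / 8 = y ^+ 2 / 2 * q.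
  rewrite /y expr_div_n exprMn sqr_sqrtr ?(ltW q0)// real_normK ?num_real//.
  by field; rewrite gt_eqF.
rewrite expRM ge0_ler_powR ?(ltW q0) ?nnegrE ?expR_ge0//.
by apply: le_trans (expR_ge1Dx _); have := sqr_ge0 (y - 1); lra.
Qed.

Lemma measurable_gauss_power (q : R) :
  measurable_fun [set: R] (fun x : R => (`|x| / (2 * Num.sqrt q)) `^ q).
Proof.
have m1 : measurable_fun [set: R] (fun x : R => `|x| / (2 * Num.sqrt q)).
  by apply: measurable_funM => //; exact: normr_measurable.
exact (measurableT_comp (@measurable_powR R q) m1).
Qed.

(** [exp z <= 1 + z exp z] for the minimum [z], with [z <= beta h] in the first
    occurrence and [z <= x ^ 2 / 8] in the second, where [h <= exp (x ^ 2 / 8)]. *)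
Lemma gauss_power (q beta : R) : 1 <= q -> 0 <= beta ->
  (\int[@gauss R]_x (expR (Num.min (beta * (`|x| / (2 * Num.sqrt q)) `^ q)
      (x ^+ 2 / 8)))%:E <= (expR (3 / 2 * beta))%:E)%E.
Proof.
move=> q1 b0.
have msq : measurable_fun [set: R] (fun x : R => x ^+ 2) by exact: measurable_funX.
have m4 : measurable_fun [set: R] (fun x : R => (expR (x ^+ 2 / 4))%:E).
  by apply/measurable_EFinP; apply: measurableT_comp => //; apply: measurable_funM.
have e40 (x : R) : (0 <= (expR (x ^+ 2 / 4))%:E)%E by rewrite lee_fin expR_ge0.
have b0E : (0 <= beta%:E)%E by rewrite lee_fin.
have mb4 : measurable_fun [set: R] (fun x : R => beta%:E * (expR (x ^+ 2 / 4))%:E)%E.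
  exact: measurable_funeM.
apply: (@le_trans _ _ (\int[@gauss R]_x (1 + beta%:E * (expR (x ^+ 2 / 4))%:E))%E).
  apply: ge0_le_integralT.
  - by move=> x; rewrite lee_fin expR_ge0.
  - apply/measurable_EFinP; apply: measurableT_comp => //.
    apply: measurable_minr; apply: measurable_funM => //.
    exact: measurable_gauss_power.
  - by apply: emeasurable_funD => //; exact: measurable_cst.
  move=> x; rewrite -EFinM -EFinD lee_fin.
  set h := _ `^ q; set y := x ^+ 2 / 8; set z := Num.min _ _.
  have h0 : 0 <= h by exact: powR_ge0.
  have hy : h <= expR y by exact: powR_le_expR_sqr8.
  have z1 : z <= beta * h by rewrite ge_min lexx.
  have z2 : z <= y by rewrite ge_min lexx orbT.
  have -> : expR (x ^+ 2 / 4) = expR y * expR y.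
    by rewrite -expRD; congr expR; rewrite /y; field.
  have ez : expR z <= 1 + z * expR z.
    have := expR_ge1Dx (- z); have := expR_gt0 z.
    have : expR z * expR (- z) = 1 by rewrite expRN divff// gt_eqF// expR_gt0.
    by nra.
  apply: le_trans ez _; rewrite lerD2l.
  apply: (@le_trans _ _ (beta * h * expR y)).
    apply: (@le_trans _ _ (beta * h * expR z)).
      by rewrite ler_wpM2r// expR_ge0.
    by rewrite ler_wpM2l ?mulr_ge0// ler_expR.
  by rewrite -mulrA ler_wpM2l// ler_wpM2r// expR_ge0.
rewrite (ge0_integralD (@gauss R) measurableT (fun _ _ => lee01)
  (measurable_cst _) (fun x _ => mule_ge0 b0E (e40 x)) mb4) integral_cstT.
rewrite (ge0_integralZl (@gauss R) measurableT m4 (fun x _ => e40 x) b0E).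
rewrite gauss_expR_sqr4 -EFinM -EFinD lee_fin; apply: le_trans (expR_ge1Dx _).
rewrite lerD2l mulrC ler_wpM2r//.
have s0 : 0 <= Num.sqrt 2 :> R by rewrite sqrtr_ge0.
have s22 : Num.sqrt 2 ^+ 2 = 2 :> R by rewrite sqr_sqrtr.
by nra.
Qed.

(** The numbers [c i j] are the remainders in Young's inequality: the [p]-th
    powers of the normalized coordinates for finite [p], and [0] for [p = +oo]. *)
Lemma escape_gt1 m n N (u : 'I_N -> 'I_m -> R) (sigma : 'I_m -> R)
    (k S q : R) (c : 'I_N -> 'I_m -> R) :
  (0 < n)%N -> (forall j, 0 < sigma j) -> 0 < S -> 1 <= q ->
  k = delta / 8 * (n%:R / q) ->
  \sum_(j < m | k <= j.+1%:R) sigma j `^ q = S `^ q ->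
  (forall i, delta ^+ 2 <= \sum_j u i j ^+ 2 <= (2 * delta) ^+ 2) ->
  (forall i j, 0 <= c i j) -> (forall i, \sum_j c i j <= 1) ->
  (forall i j al, 0 <= al -> al * (`|u i j| / sigma j) <=
     2 * delta / (960 * Num.sqrt q * (Num.sqrt n%:R)^-1 * S) * (al `^ q + c i j)) ->
  (tpow (tpow (@gauss R) m) n
     (near_kernel n u) <=
   (expR (2 - delta / 24 * n%:R))%:E)%E.
Proof.
move=> n0 sig0 S0 q1 kE SE du c0 c1 hc.
have q0 : 0 < q by lra.
pose sn := Num.sqrt n%:R : R; pose sq := Num.sqrt q.
have sn0 : 0 < sn by rewrite sqrtr_gt0 ltr0n.
have sq0 : 0 < sq by rewrite sqrtr_gt0.
have sn2 : sn ^+ 2 = n%:R by rewrite sqr_sqrtr.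
have n0R : 0 <= n%:R :> R by exact: ler0n.
pose Lam := delta / 120 * n%:R.
have Lam0 : 0 <= Lam by apply: mulr_ge0; [lra|exact: n0R].
pose theta j := (sigma j / S) `^ q.
have theta0 j : 0 <= theta j by exact: powR_ge0.
have thetaS : \sum_(j < m | k <= j.+1%:R) theta j = 1.
  transitivity (\sum_(j < m | k <= j.+1%:R) sigma j `^ q * (S `^ q)^-1).
    apply: eq_bigr => j _; rewrite /theta powRM ?(ltW (sig0 j)) ?invr_ge0 ?(ltW S0)//.
    by rewrite -powR_inv1 ?(ltW S0)// -powRrM mulN1r powRN.
  by rewrite -mulr_suml SE divff// gt_eqF// powR_gt0.
have nq : n%:R / q <= n%:R :> R by rewrite ler_pdivrMr// ler_peMr.
have nq0 : 0 <= n%:R / q :> R by rewrite divr_ge0// ltW.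
have k0 : 0 <= k by rewrite kE; apply: mulr_ge0; [lra|exact: nq0].
apply: le_trans (@escape_tail R m n N u delta k (3 / 2 * Lam) Lam
  (fun j x => Num.min (Lam * theta j * (`|x| / (2 * sq)) `^ q) (x ^+ 2 / 8))
  (fun j => 3 / 2 * (Lam * theta j))
  (fun i j => Lam * c i j) _ _ k0 du _ _ _ _ _) _.
- by lra.
- by lra.
- move=> j.
  have msq : measurable_fun [set: R] (fun x : R => x ^+ 2).
    exact: measurable_funX.
  apply: measurable_minr; last by apply: measurable_funM.
  by apply: measurable_funM => //; exact: measurable_gauss_power.
- by move=> j _; apply: gauss_power => //; rewrite mulr_ge0.
- move=> i j x _; set w := _ * u i j.
  have cc : 0 <= Lam * c i j by rewrite mulr_ge0.
  rewrite minEle; case: ifP => _; last first.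
    by have := sqr_ge0 (w - x / 8); lra.
  apply: (@le_trans _ _ (Lam * theta j * (`|x| / (2 * sq)) `^ q + Lam * c i j)); last first.
    by have := sqr_ge0 w; lra.
  pose al := sigma j / S * (`|x| / (2 * sq)).
  have s0 : 0 <= sigma j / S by rewrite divr_ge0// ltW.
  have x0 : 0 <= `|x| / (2 * sq) by rewrite divr_ge0// mulr_ge0// ltW.
  have al0 : 0 <= al by rewrite mulr_ge0.
  have alq : al `^ q = theta j * (`|x| / (2 * sq)) `^ q by rewrite powRM.
  apply: (@le_trans _ _ (4 * sn * sq * S * (al * (`|u i j| / sigma j)))).
    have -> : 4 * sn * sq * S * (al * (`|u i j| / sigma j)) = 2 * (`|w| * `|x|).
      rewrite /w normrM -/sn (gtr0_norm sn0) /al.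
      by field; rewrite !gt_eqF.
    by rewrite -mulrA ler_wpM2l// -normrM ler_norm.
  have f0 : 0 <= 4 * sn * sq * S by rewrite !mulr_ge0// ltW.
  apply: le_trans (ler_wpM2l f0 (hc i j al al0)) _.
  rewrite alq le_eqVlt; apply/orP; left; apply/eqP.
  rewrite -/sn -/sq /Lam -sn2; set h := _ `^ q; set th := theta j.
  by field; rewrite !gt_eqF.
- by rewrite -!mulr_sumr thetaS mulr1.
- move=> i; rewrite -mulr_sumr -[leRHS]mulr1 ler_wpM2l//.
  apply: le_trans (c1 i); rewrite big_mkcond; apply: ler_sum => j _.
  by case: ifP => // _; exact: c0.
(* 1 / 6 - 1 / 12 - 1 / 120 - 1 / 80 - 1 / 50 > 1 / 24, the terms coming from the
   gain, the quadratic form, Young's inequality (twice) and the first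
   coordinates *)
rewrite lee_fin ler_expR kE /Lam; move: nq n0R; set z := n%:R / q.
by set nn := n%:R; lra.
Qed.

End EscapeGt1.

(** * The law of a Gaussian matrix *)

Section MatrixLaw.
Variable R : realType.

Section Boxes.
Variables n m : nat.
Local Notation rows := (n.-tuple (m.-tuple R)).

Definition box (A : 'I_n -> 'I_m -> set R) : set rows :=
  [set t | forall i j, A i j (tnth (tnth t i) j)].

Definition boxes : set (set rows) :=
  [set B | exists2 A, (forall i j, measurable (A i j)) & B = box A].

Lemma measurable_box A : (forall i j, measurable (A i j)) -> measurable (box A).
Proof.
move=> mA.
rewrite (_ : box A = \bigcap_(i in [set: 'I_n]) \bigcap_(j in [set: 'I_m])
    ((fun t : rows => tnth (tnth t i) j) @^-1` A i j)).
  apply: fin_bigcap_measurable => // i _; apply: fin_bigcap_measurable => // j _.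
  rewrite -[X in measurable X]setTI.
  exact: (measurableT_comp (@measurable_tnth _ R m j) (@measurable_tnth _ _ n i)).
by apply/seteqP; split => t /= h i; [move=> _ j _; exact: h|move=> j; exact: h].
Qed.

Lemma boxesT : boxes setT.
Proof. by exists (fun _ _ => setT) => //; apply/seteqP. Qed.

Lemma boxesI : setI_closed boxes.
Proof.
move=> _ _ [A mA ->] [B mB ->]; exists (fun i j => A i j `&` B i j).
  by move=> i j; exact: measurableI.
apply/seteqP; split => t /=; first by move=> [hA hB] i j; split.
by move=> h; split => i j; case: (h i j).
Qed.

(** The identity map is measurable for the sigma-algebra generated by the boxes,
    since this can be tested on the entries. *)
Lemma measurable_boxes : @measurable _ rows = <<s boxes >>.
Proof.
apply/seteqP; split; last first.
  apply: smallest_sub; first exact: sigma_algebra_measurable.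
  by move=> _ [A mA ->]; exact: measurable_box.
pose id_ : g_sigma_algebraType boxes -> rows := id.
have mid : measurable_fun setT id_.
  apply/measurable_fun_tnthP => i; apply/measurable_fun_tnthP => j.
  move=> _ B mB; rewrite setTI; apply: sub_sigma_algebra.
  exists (fun i' j' => if (i' == i) && (j' == j) then B else setT).
    by move=> i' j'; case: ifP.
  apply/seteqP; split => t /=.
    by move=> h i' j'; case: ifP => // /andP[/eqP-> /eqP->].
  by move=> /(_ i j); rewrite !eqxx.
by move=> B mB; have := mid measurableT B mB; rewrite setTI.
Qed.

End Boxes.

Section Law.
Context d (T : measurableType d) (P : probability T R) (n m : nat).
Variable G : 'I_n -> 'I_m -> {RV P >-> R}.
Hypothesis gG : gaussian_matrix G.
Local Notation rows := (n.-tuple (m.-tuple R)).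

Definition rows_at (w : T) : rows := [tuple [tuple G i j w | j < m] | i < n].

Lemma tnth_rows_at w i j : tnth (tnth (rows_at w) i) j = G i j w.
Proof. by rewrite !tnth_mktuple. Qed.

Lemma measurable_rows_at : measurable_fun setT rows_at.
Proof.
apply/measurable_fun_tnthP => i; apply/measurable_fun_tnthP => j.
rewrite (_ : _ \o _ = G i j); first exact: measurable_funPT.
by apply/funext => w /=; rewrite tnth_rows_at.
Qed.

(** By independence the two laws agree on boxes, which are stable under
    intersection and generate the sigma-algebra. *)
Lemma gaussian_matrix_law (E : set rows) : measurable E ->
  P (rows_at @^-1` E) = tpow (tpow (@gauss R) m) n E.
Proof.
move=> mE.
pose mu1 := measure_function_pushforward__canonical__measure_function_Measure
  P measurable_rows_at.
rewrite [LHS](_ : _ = mu1 E)//.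
apply: (measure_unique (@boxes n m) (fun=> setT)) => //.
- exact: measurable_boxes.
- exact: boxesI.
- by move=> _; exact: boxesT.
- exact: bigcup_const.
- move=> _ [A mA ->]; have [stdG indG] := gG.
  pose B i := [set s : m.-tuple R | forall j, A i j (tnth s j)].
  have mB i : measurable (B i).
    rewrite (_ : B i = \bigcap_(j in [set: 'I_m]) ((@tnth m R)^~ j @^-1` A i j)).
      apply: fin_bigcap_measurable => // j _; rewrite -[X in measurable X]setTI.
      exact: measurable_tnth.
    by apply/seteqP; split => t /= h j; [move=> _; exact: h|exact: h].
  rewrite [RHS](_ : _ = tpow (tpow (@gauss R) m) n
      [set t | forall i, B i (tnth t i)])// tpow_box//.
  under eq_bigr do rewrite tpow_box//.
  rewrite pair_bigA/=.
  have := indG [set: 'I_n * 'I_m]%SET (fun ij => A ij.1 ij.2) (fun ij _ => mA _ _).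
  rewrite (_ : mu1 _ = P (\bigcap_(ij in [set` [set: 'I_n * 'I_m]%SET])
      (G ij.1 ij.2 @^-1` A ij.1 ij.2))).
    move=> ->; apply: eq_big => [ij|ij _]; first by rewrite inE.
    exact: (stdG ij.1 ij.2 _ (mA _ _)).
  rewrite /mu1/= /pushforward; congr (P _); apply/seteqP; split => w /=.
    by move=> h [i j] _ /=; have := h i j; rewrite tnth_rows_at.
  by move=> h i j; rewrite tnth_rows_at; apply: (h (i, j)); rewrite /= inE.
- by move=> _; rewrite /mu1/= /pushforward preimage_setT probability_setT ltry.
Qed.

End Law.

End MatrixLaw.

(** * Rational test vectors *)

Section ContinuousBig.
Variables (R : realType) (T : topologicalType).

Lemma continuous_sumr (I : Type) (s : seq I) (F : I -> T -> R) :
  (forall i, continuous (F i)) -> continuous (fun x => \sum_(i <- s) F i x).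
Proof.
move=> cF; elim: s => [|i s IH] x.
  by under eq_fun do rewrite big_nil; exact: cvg_cst.
under eq_fun do rewrite big_cons.
by apply: cvgD; [exact: cF|exact: IH].
Qed.

Lemma continuous_bigmaxr (I : Type) (s : seq I) (F : I -> T -> R) :
  (forall i, continuous (F i)) ->
  continuous (fun x => \big[Num.max/0]_(i <- s) F i x).
Proof.
move=> cF; elim: s => [|i s IH] x.
  by under eq_fun do rewrite big_nil; exact: cvg_cst.
under eq_fun do rewrite big_cons.
by apply: (@continuous_max R T (F i) _ x); [exact: cF|exact: IH].
Qed.

End ContinuousBig.

Section Gauge.
Variables (R : realType) (n m : nat) (N L : 'rV[R]_m -> R).
Hypotheses (cN : continuous N) (cL : continuous L).
Hypothesis NZ : forall c v, 0 <= c -> N (c *: v) = c * N v.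
Hypothesis LZ : forall c v, 0 <= c -> L (c *: v) = c * L v.
Hypothesis Nbounded : exists M, forall v, N v <= 1 -> `|v| <= M.
Implicit Types (A : 'I_n -> 'I_m -> R) (v : 'rV[R]_m) (q : 'rV[rat]_m).

Definition ratv q : 'rV[R]_m := map_mx ratr q.

Definition residual A v : R := \sum_i `|\sum_j A i j * v 0 j|.

Lemma residual_ge0 A v : 0 <= residual A v.
Proof. exact: sumr_ge0. Qed.

Lemma residualZ A c v : 0 <= c -> residual A (c *: v) = c * residual A v.
Proof.
move=> c0; rewrite /residual mulr_sumr; apply: eq_bigr => i _.
rewrite -[X in X * _](ger0_norm c0) -normrM mulr_sumr; congr `|_|.
by apply: eq_bigr => j _; rewrite mxE mulrCA.
Qed.

Lemma continuous_residual A : continuous (residual A).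
Proof.
have lin i : continuous (fun v => \sum_j A i j * v 0 j).
  apply: (@continuous_sumr R _ _ _ (fun j (v : 'rV[R]_m) => A i j * v 0 j)) => j v.
  apply: continuousM; first exact: cst_continuous.
  exact (@coord_continuous R 1 m 0 j v).
apply: (@continuous_sumr R _ _ _ (fun i v => `|\sum_j A i j * v 0 j|)) => i v.
exact (continuous_comp (lin i v) (@norm_continuous _ _ _)).
Qed.

Lemma ratv_dense v (U : set 'rV[R]_m) : nbhs v U -> exists q, U (ratv q).
Proof.
move=> /nbhs_ballP[e /= e0 sub].
have : forall j, exists r : rat, `|v 0 j - ratr r| < e.
  move=> j; have : v 0 j - e < v 0 j + e by lra.
  move=> /rat_in_itvoo[r]; rewrite in_itv/= => /andP[r1 r2].
  by exists r; rewrite ltr_norml; apply/andP; split; lra.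
move=> /choice[r hr]; exists (\row_j r j); apply: sub; split => [//|i j].
by rewrite !mxE (ord1 i); exact: hr.
Qed.

Lemma ratv_approx A v (a b e : R) : N v < 1 -> a < L v -> L v < b ->
  residual A v = 0 -> 0 < e ->
  exists q, [/\ N (ratv q) < 1, a < L (ratv q), L (ratv q) < b &
                residual A (ratv q) < e].
Proof.
move=> N1 aL Lb r0 e0.
have h1 : \forall w \near v, N w < 1.
  exact (@cvgr_lt R _ (nbhs v) _ N (N v) (@cN v) 1 N1).
have h2 : \forall w \near v, a < L w.
  exact (@cvgr_gt R _ (nbhs v) _ L (L v) (@cL v) a aL).
have h3 : \forall w \near v, L w < b.
  exact (@cvgr_lt R _ (nbhs v) _ L (L v) (@cL v) b Lb).
have h4 : \forall w \near v, residual A w < e.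
  have re : residual A v < e by rewrite r0.
  exact (@cvgr_lt R _ (nbhs v) _ (residual A) _ (@continuous_residual A v) e re).
have [q [[[]]]] := ratv_dense (filterI (filterI (filterI h1 h2) h3) h4).
by exists q.
Qed.

Definition escapes A (B : R) : Prop :=
  exists v, [/\ N v <= 1, B < L v & residual A v = 0].

(** Shrinking a vector of the kernel makes all conditions strict, hence open. *)
Lemma escapes_shell A B e : 0 < B -> 0 < e -> escapes A B ->
  exists q, [/\ N (ratv q) <= 1, B / 2 <= L (ratv q), L (ratv q) <= B &
                residual A (ratv q) < e].
Proof.
move=> B0 e0 [v [N1 BL r0]]; have L0 : 0 < L v by exact: lt_trans BL.
pose c := 3 / 4 * B / L v.
have c0 : 0 <= c by rewrite divr_ge0 ?(ltW L0)// mulr_ge0 ?(ltW B0)//.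
have c1 : c < 1 by rewrite ltr_pdivrMr// mul1r; lra.
have LcE : L (c *: v) = 3 / 4 * B by rewrite LZ// divfK// gt_eqF.
have [||||q [q1 q2 q3 q4]] := @ratv_approx A (c *: v) (B / 2) B e _ _ _ _ e0.
- by rewrite NZ// (le_lt_trans _ c1)// ler_piMr.
- by rewrite LcE; lra.
- by rewrite LcE; lra.
- by rewrite residualZ// r0 mulr0.
- by exists q; split => //; exact: ltW.
Qed.

(** Compactness of the part of the unit ball of [N] outside an open ball turns
    approximate kernel vectors into kernel vectors. *)
Lemma escapesP A B : 0 <= B ->
  escapes A B <->
  exists k : nat, forall l : nat, exists q,
    [/\ N (ratv q) <= 1, B + k.+1%:R^-1 <= L (ratv q) &
        residual A (ratv q) < l.+1%:R^-1].
Proof.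
move=> B0; split.
  move=> [v [N1 BL r0]]; have L0 : 0 < L v by exact: le_lt_trans BL.
  pose c := (B / L v + 1) / 2.
  have BL1 : B / L v < 1 by rewrite ltr_pdivrMr// mul1r.
  have BL0 : 0 <= B / L v by rewrite divr_ge0// ltW.
  have c0 : 0 <= c by rewrite /c; lra.
  have c1 : c < 1 by rewrite /c; lra.
  have LcE : L (c *: v) = (B + L v) / 2.
    by rewrite LZ// /c; field; rewrite gt_eqF.
  have Bc : B < L (c *: v) by rewrite LcE; lra.
  have [k hk] := ltr_add_invr Bc.
  exists k => l.
  have l0 : 0 < l.+1%:R^-1 :> R by rewrite invr_gt0.
  have [||||q [q1 q2 q3 q4]] := @ratv_approx A (c *: v) (B + k.+1%:R^-1)
    (L (c *: v) + 1) (l.+1%:R^-1) _ _ _ _ l0.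
  - by rewrite NZ// (le_lt_trans _ c1)// ler_piMr.
  - exact: hk.
  - by rewrite ltrDl.
  - by rewrite residualZ// r0 mulr0.
  - by exists q; split => //; exact: ltW.
move=> [k hk].
pose K := [set v | N v <= 1] `&` [set v | B + k.+1%:R^-1 <= L v].
have clK : closed K.
  apply: closedI.
    by apply: (closed_comp _ (@closed_le R 1)) => v _; exact: cN.
  by apply: (closed_comp _ (@closed_ge R (B + k.+1%:R^-1))) => v _; exact: cL.
have bK : bounded_set K.
  have [M hM] := Nbounded; exists M; split; first exact: num_real.
  by move=> x Mx v [v1 _]; exact: le_trans (hM v v1) (ltW Mx).
have cK := bounded_closed_compact bK clK.
have K0 : K !=set0 by have [q [q1 q2 _]] := hk 0%N; exists (ratv q).
have crK : {within K, continuous (residual A)}.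
  by apply: continuous_subspaceT; exact: continuous_residual.
have [c /set_mem[c1 c2] cmin] := compact_EVT_min K0 cK crK.
exists c; split => //; first by rewrite (lt_le_trans _ c2)// ltrDl invr_gt0.
apply/eqP; rewrite eq_le residual_ge0 andbT leNgt; apply/negP => rc.
have [l hl] := ltr_add_invr rc; rewrite add0r in hl.
have [q [q1 q2 q3]] := hk l.
have := cmin (ratv q) (mem_set (conj q1 q2)).
by rewrite leNgt (lt_trans q3 hl).
Qed.

End Gauge.

(** * The escape event *)

Section EscapeEvent.
Context (R : realType) d (T : measurableType d) (P : probability T R) (n m : nat).
Variable G : 'I_n -> 'I_m -> {RV P >-> R}.
Hypothesis gG : gaussian_matrix G.
Variables (N L : 'rV[R]_m -> R).
Hypotheses (cN : continuous N) (cL : continuous L).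
Hypothesis NZ : forall c v, 0 <= c -> N (c *: v) = c * N v.
Hypothesis LZ : forall c v, 0 <= c -> L (c *: v) = c * L v.
Hypothesis Nbounded : exists M, forall v, N v <= 1 -> `|v| <= M.

Let entries (w : T) (i : 'I_n) (j : 'I_m) : R := G i j w.

Lemma measurable_residual (v : 'rV[R]_m) :
  measurable_fun setT (fun w => residual (entries w) v).
Proof.
apply: measurable_sum => i.
have mlin : measurable_fun setT (fun w => \sum_j entries w i j * v 0 j).
  by apply: measurable_sum => j; apply: measurable_funM.
exact: (measurableT_comp (@normr_measurable _ setT) mlin).
Qed.

Lemma measurable_escapes (B : R) : 0 <= B ->
  measurable [set w | escapes N L (entries w) B].
Proof.
move=> B0.
pose D k l (q : 'rV[rat]_m) : set T :=
  if (N (ratv R q) <= 1) && (B + k.+1%:R^-1 <= L (ratv R q)) then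
    [set w | residual (entries w) (ratv R q) < l.+1%:R^-1] else set0.
rewrite (_ : mkset _ = \bigcup_k \bigcap_l \bigcup_q D k l q); last first.
  apply/seteqP; split => w /=.
    move=> /(escapesP cN cL NZ LZ Nbounded _ B0)[k hk]; exists k => // l _.
    by have [q [q1 q2 q3]] := hk l; exists q => //; rewrite /D q1 q2.
  move=> [k _ hk]; apply/(escapesP cN cL NZ LZ Nbounded _ B0).
  exists k => l; have [q _] := hk l Logic.I.
  by rewrite /D; case: ifP => // /andP[q1 q2] q3; exists q.
apply: bigcupT_measurable => k; apply: bigcapT_measurable => l.
apply: countable_bigcupT_measurable => [|q]; first exact: countableP.
rewrite /D; case: ifP => _; last exact: measurable0.
rewrite -[X in measurable X]setTI.
rewrite (_ : mkset _ = (fun w => residual (entries w) (ratv R q)) @^-1`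
  `]-oo, l.+1%:R^-1[).
  by apply: measurable_residual => //; exact: measurable_itv.
by apply/seteqP; split => w /=; rewrite in_itv.
Qed.

(** The rational vectors of the shell exhaust an increasing sequence of finite
    families, for each of which the law of the matrix gives the bound. *)
Lemma prob_escapes_le (B lam : R) (c : \bar R) : 0 < B -> 0 < lam ->
  (forall N0 (u : 'I_N0 -> 'rV[R]_m),
     (forall k, [/\ N (u k) <= 1, B / 2 <= L (u k) & L (u k) <= B]) ->
     (tpow (tpow (@gauss R) m) n (near_kernel n (fun k j => (lam * u k 0 j)%R))
        <= c)%E) ->
  (P [set w | escapes N L (entries w) B] <= c)%E.
Proof.
move=> B0 lam0 hc.
pose cond (q : 'rV[rat]_m) :=
  [&& N (ratv R q) <= 1, B / 2 <= L (ratv R q) & L (ratv R q) <= B].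
pose s K := [seq q <- pmap (@unpickle 'rV[rat]_m) (iota 0 K) | cond q].
pose u K (k : 'I_(size (s K))) : 'rV[R]_m := ratv R (nth 0 (s K) k).
pose F K := rows_at G @^-1` near_kernel n (fun k j => lam * u K k 0 j).
have uE K (k : 'I_(size (s K))) : cond (nth 0 (s K) k).
  by have := mem_nth 0 (ltn_ord k); rewrite mem_filter => /andP[].
have FP K w : F K w <->
    exists2 q, q \in s K & lam * residual (entries w) (ratv R q) < 1.
  have sumE (v : 'rV[R]_m) : \sum_(i < n) `|tdot (fun j => lam * v 0 j) (tnth (rows_at G w) i)| =
      lam * residual (entries w) v.
    rewrite /residual mulr_sumr; apply: eq_bigr => i _.
    rewrite -[X in X * _](gtr0_norm lam0) -normrM mulr_sumr; congr `|_|.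
    by apply: eq_bigr => j _; rewrite tnth_rows_at -mulrA (mulrC (v 0 j)).
  split; first by move=> [k /=]; rewrite sumE => h; exists (nth 0 (s K) k);
    rewrite ?mem_nth.
  move=> [q qs h]; have qi : (index q (s K) < size (s K))%N by rewrite index_mem.
  by exists (Ordinal qi); rewrite sumE /u/= nth_index.
have mF K : measurable (F K).
  rewrite -[X in measurable X]setTI.
  by apply: measurable_rows_at => //; exact: measurable_near_kernel.
have PF K : (P (F K) <= c)%E.
  rewrite (gaussian_matrix_law gG (measurable_near_kernel n _)); apply: hc => k.
  by have /and3P[] := uE K k.
have ndF : nondecreasing_seq F.
  move=> K K' KK'; apply/subsetPset => w /FP[q qs h]; apply/FP; exists q => //.
  move: qs; rewrite !mem_filter => /andP[-> /=].
  by move=> qs; rewrite -(subnKC KK') iotaD pmap_cat mem_cat qs.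
have mUF : measurable (\bigcup_K F K) by exact: bigcupT_measurable.
have sub : [set w | escapes N L (entries w) B] `<=` \bigcup_K F K.
  move=> w /= esc; have lV0 : 0 < lam^-1 by rewrite invr_gt0.
  have [q [q1 q2 q3 q4]] := escapes_shell cN cL NZ LZ B0 lV0 esc.
  exists (pickle q).+1 => //; apply/FP; exists q; last first.
    by rewrite -ltr_pdivlMl// mulr1.
  rewrite mem_filter /cond q1 q2 q3 -(addn1 (pickle q)) iotaD pmap_cat mem_cat/= pickleK/=.
  by rewrite mem_seq1 eqxx orbT.
have le_U : (P [set w | escapes N L (entries w) B] <= P (\bigcup_K F K))%E.
  apply: le_measure; rewrite ?inE//; apply: measurable_escapes; exact: ltW.
apply: le_trans le_U _.
have cvgF := nondecreasing_cvg_mu (mu := P) mF mUF ndF.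
have <- : limn (P \o F) = P (\bigcup_K F K) by apply: cvg_lim => //; exact: cvgF.
apply: lime_le; first by apply/cvg_ex; eexists; exact: cvgF.
by near=> K; exact: PF.
Unshelve. all: by end_near. Qed.

End EscapeEvent.

(** * The gauge of an ellipsoid *)

Section EllipsoidGauge.
Variable R : realType.
Implicit Types (m : nat) (p : \bar R).

Lemma continuous_normr_powR (r : R) : 0 < r ->
  continuous (fun x : R => `|x| `^ r).
Proof.
move=> r0 x; have [->|x0] := eqVneq x 0.
  rewrite /continuous_at normr0 powR0 ?gt_eqF//.
  apply/cvgrPdist_lt => e e0; near=> y.
  rewrite sub0r normrN ger0_norm ?powR_ge0//.
  have -> : e = (e `^ r^-1) `^ r.
    by rewrite -powRrM mulVf ?gt_eqF// powRr1// ltW.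
  rewrite gt0_ltr_powR// ?nnegrE ?powR_ge0//.
  near: y; apply/nbhs_ballP; exists (e `^ r^-1); first by rewrite /= powR_gt0.
  by move=> y; rewrite /ball/= sub0r normrN.
have a0 : `|x| \in `]0, +oo[ by rewrite in_itv/= andbT normr_gt0.
have dx : {for `|x|, continuous (@powR R ^~ r)}.
  apply: differentiable_continuous; apply/derivable1_diffP.
  exact: derivable_powR.
exact: (continuous_comp (@norm_continuous _ _ x) dx).
Unshelve. all: by end_near. Qed.

Definition gauge m p (sigma : 'I_m -> R) (v : 'rV[R]_m) : R :=
  lpnorm p (\col_j (v 0 j / sigma j)).
Arguments gauge : simpl never.

Lemma gaugeE m (r : R) (sigma : 'I_m -> R) v :
  gauge r%:E sigma v = (\sum_j `|v 0 j / sigma j| `^ r) `^ r^-1.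
Proof. by rewrite /gauge/=; under eq_bigr do rewrite mxE. Qed.

Lemma gaugeyE m (sigma : 'I_m -> R) v :
  gauge +oo%E sigma v = \big[Num.max/0]_j `|v 0 j / sigma j|.
Proof. by rewrite /gauge/=; under eq_bigr do rewrite mxE. Qed.

Lemma continuous_coord_div m (sigma : 'I_m -> R) j :
  continuous (fun v : 'rV[R]_m => v 0 j / sigma j).
Proof.
move=> v; have c := @coord_continuous R 1 m 0 j v.
exact (continuousM c (@cst_continuous 'rV[R]_m R (sigma j)^-1 v)).
Qed.

Lemma continuous_gauge m p (sigma : 'I_m -> R) : (1 <= p)%E ->
  continuous (gauge p sigma).
Proof.
case: p => [r| |]// r1.
- have r0 : 0 < r by rewrite lee_fin in r1; exact: lt_le_trans r1.
  rewrite (_ : gauge _ _ = (fun x : R => `|x| `^ r^-1) \o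
      (fun v => \sum_j `|v 0 j / sigma j| `^ r)); last first.
    apply/funext => v /=; rewrite gaugeE ger0_norm//.
    by apply: sumr_ge0 => j _; exact: powR_ge0.
  have cs : continuous (fun v : 'rV[R]_m => \sum_j `|v 0 j / sigma j| `^ r).
    apply: (@continuous_sumr R _ _ _
      (fun j (v : 'rV[R]_m) => `|v 0 j / sigma j| `^ r)) => j w.
    exact (continuous_comp (@continuous_coord_div m sigma j w)
      (@continuous_normr_powR r r0 _)).
  have rV0 : 0 < r^-1 by rewrite invr_gt0.
  move=> v; exact (continuous_comp (cs v) (@continuous_normr_powR r^-1 rV0 _)).
- rewrite (_ : gauge _ _ = fun v => \big[Num.max/0]_j `|v 0 j / sigma j|); last first.
    by apply/funext => v; rewrite gaugeyE.
  apply: (@continuous_bigmaxr R _ _ _ (fun j (v : 'rV[R]_m) => `|v 0 j / sigma j|)) => j w.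
  exact (continuous_comp (@continuous_coord_div m sigma j w) (@norm_continuous _ _ _)).
Qed.

Lemma gaugeZ m p (sigma : 'I_m -> R) (c : R) v : (1 <= p)%E -> 0 <= c ->
  gauge p sigma (c *: v) = c * gauge p sigma v.
Proof.
case: p => [r| |]// r1 c0.
- have r0 : 0 < r by rewrite lee_fin in r1; exact: lt_le_trans r1.
  rewrite !gaugeE; under eq_bigr do
    rewrite mxE -mulrA normrM (ger0_norm c0) powRM//.
  rewrite -mulr_sumr powRM ?powR_ge0//; last first.
    by apply: sumr_ge0 => j _; exact: powR_ge0.
  by rewrite -powRrM divff ?gt_eqF// powRr1.
- rewrite !gaugeyE; under eq_bigr do rewrite mxE -mulrA normrM (ger0_norm c0).
  elim/big_rec2: _ => [|j x y _ ->]; first by rewrite mulr0.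
  by rewrite maxr_pMr.
Qed.

Lemma gauge_coord m p (sigma : 'I_m -> R) (v : 'rV[R]_m) j : (1 <= p)%E ->
  `|v 0 j / sigma j| <= gauge p sigma v.
Proof.
case: p => [r| |]// r1; last by rewrite gaugeyE; exact: le_bigmax.
have r0 : 0 < r by rewrite lee_fin in r1; exact: lt_le_trans r1.
rewrite gaugeE -[leLHS]powRr1// -(@divff _ r) ?gt_eqF// powRrM.
rewrite ge0_ler_powR ?nnegrE ?powR_ge0 ?invr_ge0 ?(ltW r0)//.
  by apply: sumr_ge0 => i _; exact: powR_ge0.
by rewrite (bigD1 j)//= lerDl sumr_ge0// => i _; exact: powR_ge0.
Qed.

Lemma gauge_bounded m p (sigma : 'I_m -> R) : (1 <= p)%E ->
  (forall j, 0 < sigma j) ->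
  exists M, forall v : 'rV[R]_m, gauge p sigma v <= 1 -> `|v| <= M.
Proof.
move=> p1 sig0; exists (\sum_j sigma j) => v v1.
rewrite [leLHS]/Num.norm/= mx_normrE; apply: bigmax_le => [|[i j] _ /=].
  by apply: sumr_ge0 => j _; exact: ltW.
apply: (@le_trans _ _ (sigma j)); last first.
  by rewrite (bigD1 j)//= lerDl sumr_ge0// => k _; exact: ltW.
have := le_trans (gauge_coord sigma v j p1) v1.
by rewrite (ord1 i) normrM normfV (gtr0_norm (sig0 j)) ler_pdivrMr// mul1r.
Qed.

Lemma gauge2_sqr m (v : 'rV[R]_m) :
  gauge 2%:E (fun=> 1) v ^+ 2 = \sum_j v 0 j ^+ 2.
Proof.
rewrite gaugeE powR12_sqrt; last by apply: sumr_ge0 => j _; exact: powR_ge0.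
rewrite sqr_sqrtr; last by apply: sumr_ge0 => j _; exact: powR_ge0.
by apply: eq_bigr => j _; rewrite divr1 -[2]/(2%:R) powR_mulrn// real_normK ?num_real.
Qed.

(** The outer power of the norm does not change its unit ball. *)
Lemma gauge_le1_sum m (r : R) (sigma : 'I_m -> R) (v : 'rV[R]_m) : 1 <= r ->
  (forall j, 0 < sigma j) -> gauge r%:E sigma v <= 1 ->
  \sum_j (`|v 0 j| / sigma j) `^ r <= 1.
Proof.
move=> r1 sig0; have r0 : 0 < r by exact: lt_le_trans r1.
rewrite gaugeE => h; under eq_bigr do
  rewrite -[X in _ / X](gtr0_norm (sig0 _)) -normfV -normrM.
set S := \sum_j _ in h *.
have S0 : 0 <= S by apply: sumr_ge0 => j _; exact: powR_ge0.
rewrite leNgt; apply/negP => S1; move: h; rewrite leNgt => /negP; apply.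
have -> : 1 = 1 `^ r^-1 :> R by rewrite powR1.
by rewrite gt0_ltr_powR ?invr_gt0 ?nnegrE.
Qed.

(** The Euclidean norm enters as the gauge of the unit ball, so that both norms
    are treated alike. *)
Lemma rad_le_escapes n m p (sigma : 'I_m -> R) (A : 'M[R]_(n, m)) (B : R) :
  (rad (ellipsoid p sigma) A <= B%:E)%E <->
  ~ escapes (gauge p sigma) (gauge 2%:E (fun=> 1)) (fun i j => A i j) B.
Proof.
have resE (v : 'rV[R]_m) : residual (fun i j => A i j) v = 0 <-> A *m v^T = 0.
  split.
    move=> /eqP; rewrite psumr_eq0// => /allP h; apply/colP => i; rewrite !mxE.
    move: (h i (mem_index_enum i)); rewrite /= normr_eq0 => /eqP e; rewrite -[RHS]e.
    by apply: eq_bigr => j _; rewrite mxE.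
  move=> h; apply: big1 => i _; have := congr1 (fun M : 'cV[R]_n => M i 0) h.
  rewrite !mxE => e; apply/eqP; rewrite normr_eq0; apply/eqP; rewrite -[RHS]e.
  by apply: eq_bigr => j _; rewrite mxE.
have LE (v : 'rV[R]_m) : gauge 2%:E (fun=> 1) v = lpnorm 2%:E v^T.
  by rewrite /gauge; congr lpnorm; apply/colP => j; rewrite !mxE divr1.
have NE (v : 'rV[R]_m) : ellipsoid p sigma v^T <-> gauge p sigma v <= 1.
  rewrite /ellipsoid /gauge/= (_ : \col_j (v^T j 0 / sigma j) = \col_j (v 0 j / sigma j))//.
  by apply/colP => j; rewrite !mxE.
split.
  move=> radB [v [v1 Bv /resE Av]]; move: Bv; rewrite ltNge => /negP; apply.
  rewrite -lee_fin; apply: le_trans radB; apply: ereal_sup_ubound.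
  by exists v^T; [split => //; exact/NE|rewrite LE].
move=> nesc; apply: ge_ereal_sup => _ [x [xE Ax] <-].
rewrite lee_fin leNgt; apply/negP => Bx; apply: nesc.
exists x^T; split.
- by apply/NE; rewrite trmxK.
- by rewrite LE trmxK.
- by apply/resE; rewrite trmxK.
Qed.

End EllipsoidGauge.

(** * The bound for the radius *)

Section Constants.
Variable R : realType.
Local Notation delta := (384^-1 : R).

Definition tail_index (p : \bar R) (n : nat) : R :=
  if p == 1%E then delta / 8 * n%:R else delta / 8 * (n%:R / pconj p).

Lemma pconj_fin (r : R) : 1 < r -> pconj r%:E = r / (r - 1).
Proof.
move=> r1; rewrite /pconj /hoelder_conjugate/= eqe gt_eqF ?(lt_trans ltr01)//.
by rewrite -EFinD inver subr_eq0 gt_eqF.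
Qed.

Lemma pconjy : pconj (+oo%E : \bar R) = 1.
Proof. by []. Qed.

Lemma pconj_ge1 (p : \bar R) : (1 <= p)%E -> p != 1%E -> 1 <= pconj p.
Proof.
move=> p1 pN1; have {p1 pN1} : (1 < p)%E by rewrite lt_neqAle eq_sym pN1.
case: p => [r| |]//; rewrite lte_fin => r1; rewrite pconj_fin// ler_pdivlMr ?subr_gt0// mul1r.
by rewrite gerBl.
Qed.

Lemma tail_index_gt0 (p : \bar R) (n : nat) : (1 <= p)%E -> (0 < n)%N ->
  0 < tail_index p n.
Proof.
move=> p1 n0; have nR : 0 < n%:R :> R by rewrite ltr0n.
rewrite /tail_index; have [_|pN1] := eqVneq p 1%E.
  by apply: mulr_gt0; [lra|exact: nR].
apply: mulr_gt0; first by lra.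
by rewrite divr_gt0// (lt_le_trans ltr01)// pconj_ge1.
Qed.

Lemma tail_index_le (p : \bar R) (m n : nat) : (1 <= p)%E -> (n < m)%N ->
  tail_index p n <= m%:R.
Proof.
move=> p1 nm; have nR : 0 <= n%:R :> R by exact: ler0n.
apply: (@le_trans _ _ (n%:R : R)); last by rewrite ler_nat ltnW.
rewrite /tail_index; have [_|pN1] := eqVneq p 1%E; first by lra.
have q1 := pconj_ge1 p1 pN1; have q0 : 0 < pconj p by exact: lt_le_trans q1.
have : n%:R / pconj p <= n%:R by rewrite ler_pdivrMr// ler_peMr.
have : 0 <= n%:R / pconj p by rewrite divr_ge0// ltW.
by set z := n%:R / pconj p; lra.
Qed.

Section Ellipsoid.
Variables (p : \bar R) (m n : nat) (sigma : 'I_m -> R).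
Hypotheses (p1 : (1 <= p)%E) (n0 : (0 < n)%N) (nm : (n < m)%N).
Hypothesis sig0 : forall j, 0 < sigma j.
Local Notation k := (tail_index p n).
Local Notation B := (rad_bound 960 p n sigma k).

Lemma tail_nonempty : exists j : 'I_m, k <= j.+1%:R.
Proof.
have m0 : (0 < m)%N by exact: leq_ltn_trans nm.
have mm : (m.-1 < m)%N by rewrite prednK.
by exists (Ordinal mm); rewrite /= prednK//; exact: tail_index_le.
Qed.

Lemma rad_bound1_gt0 :
  0 < \big[Num.max/0]_(j < m | k <= j.+1%:R)
        (sigma j * Num.sqrt (ln j.+1%:R + 1)).
Proof.
have [j kj] := tail_nonempty.
apply: lt_le_trans (le_bigmax_cond _ (fun j : 'I_m =>
  sigma j * Num.sqrt (ln j.+1%:R + 1)) kj).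
by rewrite mulr_gt0// sqrtr_gt0 ltr_wpDl// ln_ge0// ler1n.
Qed.

Lemma rad_bound_sum_gt0 (q : R) :
  0 < \sum_(j < m | k <= j.+1%:R) sigma j `^ q.
Proof.
have [j kj] := tail_nonempty; rewrite (bigD1 j)//=.
by rewrite ltr_pwDl ?powR_gt0// sumr_ge0// => i _; exact: powR_ge0.
Qed.

Lemma rad_bound_gt0 : 0 < B.
Proof.
have sn0 : 0 < (Num.sqrt n%:R)^-1 :> R by rewrite invr_gt0 sqrtr_gt0 ltr0n.
have c0 : 0 < 960 :> R by rewrite ltr0n.
rewrite /rad_bound; have [pE|pN1] := eqVneq p 1%E.
  exact (mulr_gt0 (mulr_gt0 c0 sn0) rad_bound1_gt0).
have q0 : 0 < pconj p by rewrite (lt_le_trans ltr01)// pconj_ge1.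
apply: mulr_gt0; last by rewrite powR_gt0// rad_bound_sum_gt0.
by apply: mulr_gt0 sn0; apply: (mulr_gt0 c0); rewrite sqrtr_gt0.
Qed.

(** Rescaled by [2 delta / B], the vectors of the shell have a length between
    [delta] and [2 delta], as both tail estimates require. *)
Lemma escape_ellipsoid N (u : 'I_N -> 'rV[R]_m) :
  (forall i, [/\ gauge p sigma (u i) <= 1, B / 2 <= gauge 2%:E (fun=> 1) (u i) &
                 gauge 2%:E (fun=> 1) (u i) <= B]) ->
  (tpow (tpow (@gauss R) m) n
     (near_kernel n (fun i j => 2 * delta / B * u i 0 j)%R) <=
   (expR (2 - delta / 24 * n%:R))%:E)%E.
Proof.
move=> hu; have B0 := rad_bound_gt0.
set lam := 2 * delta / B.
have d2 : 0 < 2 * delta by lra.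
have lam0 : 0 < lam by exact: divr_gt0.
have lamB : lam * B = 2 * delta by rewrite divfK// gt_eqF.
have lam_div i j : `|lam * u i 0 j| / sigma j = lam * (`|u i 0 j| / sigma j).
  by rewrite normrM (gtr0_norm lam0) mulrA.
have du i : delta ^+ 2 <= \sum_j (lam * u i 0 j) ^+ 2 <= (2 * delta) ^+ 2.
  have -> : \sum_j (lam * u i 0 j) ^+ 2 = (lam * gauge 2%:E (fun=> 1) (u i)) ^+ 2.
    rewrite exprMn gauge2_sqr mulr_sumr; apply: eq_bigr => j _.
    by rewrite exprMn.
  have [_ lo hi] := hu i; set L := gauge _ _ _ in lo hi *.
  have L1 : delta <= lam * L.
    by have := ler_wpM2l (ltW lam0) lo; rewrite mulrA lamB; lra.
  have L2 : lam * L <= 2 * delta by rewrite -lamB ler_wpM2l// ltW.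
  have d0 : 0 <= delta by rewrite invr_ge0 ler0n.
  have L0 : 0 <= lam * L := le_trans d0 L1.
  apply/andP; split; first exact: lerXn2r d0 L0 L1.
  exact: lerXn2r L0 (ltW d2) L2.
case: (eqVneq p 1%E) => [pE|pN1].
  have S0 := rad_bound1_gt0; set S := \big[_/_]_(_ < _ | _) _ in S0.
  have BE : B = 960 * (Num.sqrt n%:R)^-1 * S by rewrite /rad_bound pE eqxx /S pE.
  apply: (@escape_one R m n N _ sigma k S n0 sig0 S0 _ _ du).
  - by rewrite /tail_index pE eqxx.
  - move=> j kj; exact: (le_bigmax_cond _ (fun j : 'I_m =>
      sigma j * Num.sqrt (ln j.+1%:R + 1)) kj).
  - move=> i; rewrite -BE -/lam; under eq_bigr do rewrite lam_div.
    rewrite -mulr_sumr -[leRHS]mulr1 ler_wpM2l// ?(ltW lam0)//.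
    have [u1 _ _] := hu i; rewrite pE in u1.
    have := gauge_le1_sum (lexx 1) sig0 u1; congr (_ <= _).
    by apply: eq_bigr => j _; rewrite powRr1// divr_ge0// ltW.
have q1 := pconj_ge1 p1 pN1; set q := pconj p in q1.
have q0 : 0 < q by exact: lt_le_trans q1.
have Sum0 := rad_bound_sum_gt0 q.
pose S := (\sum_(j < m | k <= j.+1%:R) sigma j `^ q) `^ q^-1.
have S0 : 0 < S by rewrite powR_gt0.
have SE : \sum_(j < m | k <= j.+1%:R) sigma j `^ q = S `^ q.
  by rewrite /S -powRrM mulVf ?gt_eqF// powRr1// ltW.
have BE : B = 960 * Num.sqrt q * (Num.sqrt n%:R)^-1 * S.
  by rewrite /rad_bound (negbTE pN1).
have kE : k = delta / 8 * (n%:R / q) by rewrite /tail_index (negbTE pN1).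
have y0 i j : 0 <= `|u i 0 j| / sigma j by rewrite divr_ge0// ltW.
(* Young's inequality; for p = +oo it degenerates, the vectors being bounded *)
have [c [c0 c1 young]] : exists c : 'I_N -> 'I_m -> R,
    [/\ forall i j, 0 <= c i j, forall i, \sum_j c i j <= 1 &
        forall i j al, 0 <= al ->
          al * (`|u i 0 j| / sigma j) <= al `^ q + c i j].
  have pgt1 : (1 < p)%E by rewrite lt_neqAle eq_sym pN1.
  have [[r pr]|py] : (exists r, p = r%:E) \/ p = +oo%E.
  - by case: (p) p1 => [r| |]// _; [left; exists r|right].
  - have r1 : 1 < r by rewrite -lte_fin -pr.
    have r0 : 0 < r by exact: lt_trans r1.
    have qE : q = r / (r - 1) by rewrite /q pr pconj_fin.
    exists (fun i j => (`|u i 0 j| / sigma j) `^ r); split.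
    + by move=> i j; exact: powR_ge0.
    + move=> i; have [u1 _ _] := hu i; rewrite pr in u1.
      exact: gauge_le1_sum (ltW r1) sig0 u1.
    + move=> i j al al0.
      have qr : q^-1 + r^-1 = 1.
        by rewrite qE; field; rewrite gt_eqF//= subr_eq0 gt_eqF.
      apply: le_trans (conjugate_powR al0 (y0 i j) q0 r0 qr) _.
      apply: lerD.
        by rewrite ler_pdivrMr// ler_peMr// powR_ge0.
      by rewrite ler_pdivrMr// ler_peMr ?powR_ge0// ltW.
  - have qE : q = 1 by rewrite /q py pconjy.
    exists (fun _ _ => 0); split=> //; first by move=> i; rewrite big1.
    move=> i j al al0; rewrite addr0 qE powRr1// ler_piMr//.
    have [u1 _ _] := hu i; have := le_trans (gauge_coord sigma (u i) j p1) u1.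
    by rewrite normrM normfV (gtr0_norm (sig0 j)).
apply: (@escape_gt1 R m n N _ sigma k S q c n0 sig0 S0 q1 kE SE du c0 c1).
move=> i j al al0; rewrite -BE -/lam lam_div mulrCA.
by rewrite ler_wpM2l ?(ltW lam0)// young.
Qed.

End Ellipsoid.
End Constants.

Theorem theorem1 (R : realType) :
  exists C c1 c2 a b : R,
    [/\ 0 < C, 0 < c1, 0 < c2, 0 < a & 0 < b] /\ a <= b /\
    forall (p : \bar R) (m n : nat) (sigma : 'I_m -> R),
      (1 <= p)%E -> (1 <= n)%N -> (n < m)%N ->
      (forall i j : 'I_m, (i <= j)%N -> sigma j <= sigma i) ->
      (forall j : 'I_m, 0 < sigma j) ->
      exists k : R,
        [/\ 0 < k,
            p = 1%E -> a * n%:R <= k <= b * n%:R,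
            (1 < p)%E -> a * (n%:R / pconj p) <= k <= b * (n%:R / pconj p) &
            forall (d : measure_display) (T : measurableType d)
              (P : probability T R) (G : 'I_n -> 'I_m -> {RV P >-> R}),
              gaussian_matrix G ->
              let good := [set w | (rad (ellipsoid p sigma) (matrix_at G w)
                                    <= (rad_bound C p n sigma k)%:E)%E] in
              measurable good /\
              ((1 - c1 * expR (- c2 * n%:R))%:E <= P good)%E].
Proof.
(* With delta = 1 / 384, the constant 960 makes the tail cost at most
   n delta / 48 in the exponent, up to an additive constant that is absorbed by
   exp 2; the other constants are delta / 24 and delta / 8. *)
exists 960, (expR 2), (384^-1 / 24), (384^-1 / 8), (384^-1 / 8).
split; first by split; [lra|exact: expR_gt0|lra|lra|lra].
split; first exact: lexx.
move=> p m n sigma p1 n1 nm _ sig0.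
exists (tail_index p n); split.
- exact: tail_index_gt0.
- by move=> ->; rewrite /tail_index eqxx lexx.
- by move=> pgt1; rewrite /tail_index gt_eqF// lexx.
move=> d T P G gG good.
set B := rad_bound _ _ _ _ _ in good *.
have B0 : 0 < B by exact: rad_bound_gt0.
pose bad := [set w | escapes (gauge p sigma) (gauge 2%:E (fun=> 1))
  (fun i j => G i j w) B].
(* matrix_at G w i j is only provably equal to G i j w *)
have goodE : good = ~` bad.
  apply/seteqP; split => w /=.
    move=> /rad_le_escapes; apply: contra_not; rewrite /bad/= => -[v [v1 v2 v3]].
    exists v; split => //; rewrite -v3.
    by apply: eq_bigr => i _; congr `|_|; apply: eq_bigr => j _; rewrite mxE.
  move=> nbad; apply/rad_le_escapes; move: nbad; apply: contra_not.
  move=> -[v [v1 v2 v3]]; exists v; split => //; rewrite -v3.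
  by apply: eq_bigr => i _; congr `|_|; apply: eq_bigr => j _; rewrite mxE.
have p2 : (1 <= 2%:E :> \bar R)%E by rewrite lee_fin ler1n.
have cN : continuous (gauge p sigma) by exact: continuous_gauge.
have cL : continuous (gauge 2%:E (fun _ : 'I_m => 1 : R)).
  exact: continuous_gauge.
have NZ c v : 0 <= c -> gauge p sigma (c *: v) = c * gauge p sigma v.
  exact: gaugeZ.
have LZ c (v : 'rV[R]_m) : 0 <= c ->
    gauge 2%:E (fun=> 1) (c *: v) = c * gauge 2%:E (fun=> 1) v.
  exact: gaugeZ.
have Nb := gauge_bounded p1 sig0.
have mbad : measurable bad.
  exact (measurable_escapes G cN cL NZ LZ Nb (ltW B0)).
split; first by rewrite goodE; exact: measurableC.
rewrite goodE probability_setC//.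
have d0 : 0 < 2 * 384^-1 :> R by lra.
have lam0 : 0 < 2 * 384^-1 / B := divr_gt0 d0 B0.
have bound : (P bad <= (expR (2 - 384^-1 / 24 * n%:R))%:E)%E.
  apply: (prob_escapes_le gG cN cL NZ LZ Nb B0 lam0) => N u hu.
  exact: escape_ellipsoid.
rewrite mulNr -expRD EFinB leeB//.
Qed.
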